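(* Let $(h,T,\lambda,\mu)$ and $(\tilde h,\tilde T,\tilde\lambda,\tilde\mu)$ be two IMCA parameter sets, each satisfying: (I) the data model is the IMCA model; (II) the mixing function is invertible; (III) the conditional latent distribution is strongly exponential with differentiable sufficient statistic; (IV) there exist $k+1$ distinct points $y^0,\dots,y^k$ with $\big(\lambda(y^1)-\lambda(y^0),\dots,\lambda(y^k)-\lambda(y^0)\big)$ invertible; and in addition either (V) the sufficient statistic is twice differentiable with $\dim(T_l)\ge2$ for all $l$ and (VI) the mixing function is a $\mathcal{D}^2$-diffeomorphism; or (V') $\dim(T_l)=1$ and $T_l$ is non-monotonic for all $l$ and (VI') the mixing function is a $C^1$-diffeomorphism. If $p(x\mid y)=\tilde p(x\mid y)$ for all $x,y$, then there exist a permutation $\gamma$ of $\{1,\dots,d\}$, invertible square matrices $A_i$ and vectors $b_i$ such that for all $i$ and all $x$, $T_i(z_i)=A_i\tilde T_{\gamma(i)}(\tilde z_{\gamma(i)})+b_i$, where $z=h^{-1}(x)$ and $\tilde z=\tilde h^{-1}(x)$.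
   Context: IMCA model with parameters $(h,T,\lambda,\mu)$: a latent $z\in\mathbb{R}^d$ and an observed auxiliary variable $y\in\mathcal{Y}$, with $z\sim p(z\mid y)$ and $x=h(z)$, where $p(z\mid y)=\mu(z)\exp\big(\sum_{i=1}^d T_i(z_i)^\top\lambda_i(y)-\Gamma(y)\big)$, $\mu$ an arbitrary (not necessarily factorized) base measure density, $T_i:\mathbb{R}\to\mathbb{R}^{k_i}$, $\lambda_i:\mathcal{Y}\to\mathbb{R}^{k_i}$, $\Gamma$ the log-normalizer, $k=\sum_ik_i$, and $T,\lambda$ the stacked vectors in $\mathbb{R}^k$; $p(x\mid y)$ is the induced density of $x$. The distribution is strongly exponential if for each $i$, every measurable $U\subset\mathbb{R}$ and every $\eta\in\mathbb{R}^{k_i}$: if $u\mapsto T_i(u)^\top\eta$ is constant on $U$, then $U$ has Lebesgue measure zero or $\eta=0$. A $\mathcal{D}^2$-diffeomorphism is an invertible map such that all second-order cross-derivatives of the map and its inverse exist; a $C^1$-diffeomorphism is an invertible map such that all partial derivatives of the map and its inverse exist and are continuous.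
   Formalization: The base densities μ and μ̃ are assumed strictly positive everywhere; if they may vanish on an open set, the mixing functions are undetermined there and the relation can fail for such x. The alternative (V),(VI) or (V'),(VI') is taken jointly for both parameter sets. *)

(* Defs.v *)
From HB Require Import structures.
From mathcomp Require Import all_boot all_order all_algebra.
From mathcomp Require Import all_classical all_reals all_analysis.
Set Implicit Arguments. Unset Strict Implicit. Unset Printing Implicit Defensive.
Import Order.TTheory GRing.Theory Num.Theory.
Import numFieldNormedType.Exports.
Local Open Scope classical_set_scope.
Local Open Scope ring_scope.

Section IMCA.
Variables (R : realType) (d : nat) (Y : Type).

Definition inner n (u v : 'rV[R]_n) : R := (u *m v^T) 0 0.

Definition ebasis (i : 'I_d) : 'rV[R]_d := delta_mx 0 i.

Fixpoint iter_int (n : nat) (f : (nat -> R) -> \bar R) (z : nat -> R) : \bar R :=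
  match n with
  | 0 => f z
  | m.+1 => (\int[@lebesgue_measure R]_t
               iter_int m f (fun j => if j == m then t else z j))%E
  end.

(* Lebesgue integral over R^d (as an iterated integral; for the nonnegative
   integrands used below this is the d-dimensional Lebesgue integral). *)
Definition integral_Rd (g : 'rV[R]_d -> R) : \bar R :=
  iter_int d (fun z => (g (\row_(i < d) z (val i)))%:E) (fun _ => 0).

Variables (k : 'I_d -> nat).

Definition stack (lam : forall i : 'I_d, Y -> 'rV[R]_(k i)) (y : Y)
  : 'rV[R]_(\sum_(i < d) k i) := \mxrow_(i < d) lam i y.

Definition pz (T : forall i : 'I_d, R -> 'rV[R]_(k i))
  (lam : forall i : 'I_d, Y -> 'rV[R]_(k i)) (mu : 'rV[R]_d -> R)
  (Gam : Y -> R) (y : Y) (z : 'rV[R]_d) : R :=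
  mu z * expR (\sum_(i < d) inner (T i (z 0 i)) (lam i y) - Gam y).

Definition jacobian (f : 'rV[R]_d -> 'rV[R]_d) (x : 'rV[R]_d) : 'M[R]_d :=
  \matrix_(a < d, b < d) ('D_(ebasis b) f x) 0 a.

Definition px T lam mu Gam (hinv : 'rV[R]_d -> 'rV[R]_d) (y : Y)
  (x : 'rV[R]_d) : R :=
  pz T lam mu Gam y (hinv x) * `|\det (jacobian hinv x)|.

Definition strongly_exponential (T : forall i : 'I_d, R -> 'rV[R]_(k i)) :=
  forall (i : 'I_d) (U : set R) (eta : 'rV[R]_(k i)),
    measurable U ->
    (exists c : R, forall u, U u -> inner (T i u) eta = c) ->
    (@lebesgue_measure R U = 0%E \/ eta = 0).

Definition imca_basic (T : forall i : 'I_d, R -> 'rV[R]_(k i))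
  (lam : forall i : 'I_d, Y -> 'rV[R]_(k i)) (mu : 'rV[R]_d -> R)
  (Gam : Y -> R) (h hinv : 'rV[R]_d -> 'rV[R]_d) : Prop :=
  [/\ (* (I) IMCA model: mu a (positive) base density, p(.|y) normalized *)
      (forall z, 0 < mu z),
      (forall y, integral_Rd (pz T lam mu Gam y) = 1%E),
      cancel h hinv /\ cancel hinv h,
      strongly_exponential T /\ (forall i u, derivable (T i) u 1) &
      exists ys : 'I_(\sum_(i < d) k i).+1 -> Y,
        injective ys /\
        (\matrix_(l < \sum_(i < d) k i)
           (stack lam (ys (lift ord0 l)) - stack lam (ys ord0)))
          \in unitmx].

Definition cond_V (T : forall i : 'I_d, R -> 'rV[R]_(k i)) : Prop :=
  (forall i u, derivable (T i) u 1 /\ derivable (derive1 (T i)) u 1) /\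
  (forall i, (2 <= k i)%N).

Definition monotone (f : R -> R) : Prop :=
  (forall a b, a <= b -> f a <= f b) \/ (forall a b, a <= b -> f b <= f a).

Definition cond_V' (T : forall i : 'I_d, R -> 'rV[R]_(k i)) : Prop :=
  forall i, k i = 1%N /\ (forall j : 'I_(k i), ~ monotone (fun u => T i u 0 j)).

End IMCA.

Definition D2_diffeo (R : realType) (d : nat)
  (f finv : 'rV[R]_d -> 'rV[R]_d) : Prop :=
  cancel f finv /\ cancel finv f /\
  forall g, (g = f \/ g = finv) ->
    (forall x i, derivable g x (ebasis R i)) /\
    (forall x (i j : 'I_d), i != j ->
        derivable ('D_(ebasis R i) g) x (ebasis R j)).

Definition C1_diffeo (R : realType) (d : nat)
  (f finv : 'rV[R]_d -> 'rV[R]_d) : Prop :=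
  cancel f finv /\ cancel finv f /\
  forall g, (g = f \/ g = finv) ->
    (forall x i, derivable g x (ebasis R i)) /\
    (forall i, continuous ('D_(ebasis R i) g)).

(* Main.v *)
Require Import Defs.
From HB Require Import structures.
From mathcomp Require Import all_boot all_order all_algebra perm.
From mathcomp Require Import all_classical all_reals all_analysis.
From mathcomp Require Import ring lra.
Set Implicit Arguments. Unset Strict Implicit. Unset Printing Implicit Defensive.
Import Order.TTheory GRing.Theory Num.Theory.
Import numFieldNormedType.Exports.
Local Open Scope classical_set_scope.
Local Open Scope ring_scope.

(** The two densities give an affine relation between the stacked statistics
at every point where the Jacobian determinant is nonzero.  A D2-diffeomorphism
need not be continuous, let alone differentiable, so this set has to be studied
by a category argument: call a set sep-open when its trace on every line
parallel to an axis is open.  R^d with this topology still has the Baire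
property, with conclusions about Euclidean boxes, and a map with partial
derivatives is sep-continuous.  Hence such a map is Lipschitz, and nearly linear,
on many boxes; and since a sep-continuous inverse makes images of boxes sep-open,
the Jacobian determinant is nonzero on a dense set, from which the affine
relation extends to all points.

Each statistic of the second model is then a sum of functions of single latent
coordinates of the first.  In case (V) its image is a C^1 curve which affinely
spans a space of dimension at least 2; a sum depending on two coordinates would
sweep out a surface or a piece of a line.  In case (V') a non-monotonic statistic
has a local extremum, and on the corresponding level hypersurface every
coordinate on which the sum depends is constant, so there is only one of them.
The matrix of the affine relation is therefore a block permutation. *)

Local Notation jacobian := Defs.jacobian.

(** * The cross topology *)

Section CrossTopology.
Context {R : realType} {d : nat}.
Implicit Types (x y c : 'rV[R]_d) (i j : 'I_d) (F W : set 'rV[R]_d).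

Definition upd x i (t : R) : 'rV[R]_d := \row_j (if j == i then t else x 0 j).

Lemma updE x i t j : upd x i t 0 j = if j == i then t else x 0 j.
Proof. by rewrite mxE. Qed.

Lemma upd_id x i : upd x i (x 0 i) = x.
Proof. by apply/rowP => j; rewrite updE; case: eqP => // ->. Qed.

Lemma upd_upd x i s t : upd (upd x i s) i t = upd x i t.
Proof. by apply/rowP => j; rewrite !updE; case: eqP. Qed.

Lemma upd_comm x i j s t : i != j -> upd (upd x i s) j t = upd (upd x j t) i s.
Proof.
move=> ij; apply/rowP => k; rewrite !updE.
by case: (eqVneq k j) => // ->; rewrite eq_sym (negPf ij).
Qed.

Lemma upd_shift x i s : upd x i (x 0 i + s) = s *: ebasis R i + x.
Proof.
apply/rowP => j; rewrite updE !mxE eqxx /= eq_sym.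
by case: eqP => [->|_]; rewrite /= ?mulr1 ?mulr0 ?add0r // addrC.
Qed.

Lemma upd_add x i t y : upd x i t + y = upd (x + y) i (t + y 0 i).
Proof.
by apply/rowP => j; rewrite mxE !updE; case: eqP => [->|_] //; rewrite mxE.
Qed.

Definition sep_open W := forall x i, open [set t | W (upd x i t)].
Definition sep_closed F := forall x i, closed [set t | F (upd x i t)].

Definition box c (r : R) : set 'rV[R]_d :=
  [set x | forall i, `|x 0 i - c 0 i| < r].

(** If no [C k] contained an interval, the complements would be dense and open, and a point of [O]
    common to all of them would be left uncovered. The interval found need not lie in [O]. *)
Lemma baire_interval (I : countType) (O : set R) (C : I -> set R) :
  open O -> O !=set0 -> (forall k, closed (C k)) ->
  (forall t, O t -> exists k, C k t) ->
  exists k q r, 0 < r /\ forall t, `|t - q| < r -> C k t.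
Proof.
move=> oO O0 cC cov; apply: contrapT => noint.
(* Naturals that code no index receive the whole line, so that Baire applies to a sequence. *)
pose G (n : nat) : set R := if unpickle n is Some k then ~` C k else setT.
have : dense (\bigcap_n G n).
  apply: (@Baire R R^o) => n; rewrite /G; case: (unpickle n) => [k|]; last first.
    by split; [exact: openT | move=> S S0 _; rewrite setIT].
  split; first exact: closed_openC.
  move=> S [t St] oS; apply: contrapT => /set0P/negP/negPn/eqP SC0.
  have /nbhs_ballP[r /= r0 rS] : nbhs t S by exact: open_nbhs_nbhs.
  apply: noint; exists k, t, r; split => // u ut.
  apply: contrapT => nC.
  have : (S `&` ~` C k) u.
    by split => //; apply: rS; rewrite /ball /= distrC.
  by rewrite SC0.
move=> /(_ O O0 oO)[t [Ot Gt]].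
have [k Ck] := cov _ Ot.
by have := Gt (pickle k) Logic.I; rewrite /G pickleK.
Qed.

(** Induction on the number [n] of free coordinates, the others being frozen at those of [p]. Baire
    on the line turns one more coordinate into an interval; rational centres and radii [1/(m+1)]
    keep the new index set countable, which is why [I] is an arbitrary countable type. *)
Lemma sep_baire_slice n (I : countType) (F : I -> set 'rV[R]_d) W p :
  (forall x i, (i < n)%N -> open [set t | W (upd x i t)]) ->
  (forall k x i, (i < n)%N -> closed [set t | F k (upd x i t)]) ->
  W p ->
  (forall x, W x -> (forall j, (n <= j)%N -> x 0 j = p 0 j) ->
     exists k, F k x) ->
  exists k c r, 0 < r /\ forall x,
    (forall i, (i < n)%N -> `|x 0 i - c 0 i| < r) ->
    (forall j, (n <= j)%N -> x 0 j = p 0 j) -> F k x.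
Proof.
elim: n I F => [|n IH] I F oW cF Wp cov.
  have [k Fk] := cov p Wp (fun _ _ => erefl).
  exists k, p, 1; split => // x _ xp.
  by have -> : x = p by apply/rowP => j; exact: xp.
have [nd|dn] := ltnP n d; last first.
  have lt i : (i < n)%N by exact: leq_trans (ltn_ord i) dn.
  case: (IH I F) => //.
  - by move=> x i _; apply/oW/ltnW; rewrite ltnS.
  - by move=> k x i _; apply/cF/ltnW; rewrite ltnS.
  - move=> x Wx xp; apply: cov => // j nj; apply: xp; exact: ltnW.
  move=> k [c [r [r0 H]]]; exists k, c, r; split => // x xc _.
  by apply: H => [i _|j]; [apply/xc/ltnW; rewrite ltnS | rewrite leqNgt lt].
pose j := Ordinal nd.
pose X (K : I * rat * nat) : set 'rV[R]_d :=
  [set x | forall t, `|t - ratr K.1.2| < K.2.+1%:R^-1 -> F K.1.1 (upd x j t)].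
case: (IH _ X).
- by move=> x i ni; apply/oW/ltnW.
- move=> [[k q] m] x i ni.
  have -> : [set t | X (k, q, m) (upd x i t)] =
     \bigcap_(s in [set s : R | `|s - ratr q| < m.+1%:R^-1])
        [set t | F k (upd (upd x j s) i t)].
    have ij : i != j by rewrite neq_ltn ni.
    apply/seteqP; split => t /= H s qs /=; last by rewrite upd_comm //; exact: H.
    by rewrite upd_comm; [exact: H | rewrite eq_sym].
  by apply: closed_bigI => s _; apply: cF; exact: ltnW.
- by [].
- move=> x Wx xp.
  have := @baire_interval I [set t | W (upd x j t)]
    (fun k => [set t | F k (upd x j t)]).
  case.
  + exact: oW.
  + by exists (x 0 j); rewrite /= upd_id.
  + by move=> k; exact: cF.
  + move=> t Wt; apply: cov => // i ni; rewrite updE ifF.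
      by apply/xp/ltnW.
    by apply/negP => /eqP ij; rewrite ij ltnn in ni.
  move=> k [q [r [r0 H]]].
  (* A rational centre within [r / 2] of [q], with a radius below [r / 2], stays inside the interval
     found. *)
  have r20 : 0 < r / 2 by lra.
  have [q' /= q'P] : exists q', ratr q' \in `](q - r / 2), (q + r / 2)[.
    by apply: rat_in_itvoo; rewrite ltrBlDr -addrA ltrDl addr_gt0.
  have [m mr] : exists m, m.+1%:R^-1 < r / 2.
    have := @near_infty_natSinv_lt R (PosNum r20) => -[m _ /(_ m (leqnn m))].
    by exists m.
  exists (k, q', m) => t /= tq; apply: H.
  move: q'P; rewrite in_itv /= => /andP[q1 q2].
  have {}tq := lt_trans tq mr.
  rewrite (_ : t - q = (t - ratr q') + (ratr q' - q)); last by rewrite addrA subrK.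
  rewrite (le_lt_trans (ler_normD _ _))// [ltRHS](splitr r) ltrD//.
  by rewrite ltr_norml ltrBrDl q1 ltrBlDl.
move=> [[k q] m] [c [r [r0 H]]].
exists k, (upd c j (ratr q)), (Num.min r m.+1%:R^-1); split.
  by rewrite lt_min r0 invr_gt0 ltr0Sn.
move=> x xc xp.
(* Membership in [X] ignores the coordinate [j], which may thus be reset to [p 0 j] as the induction
   hypothesis requires. *)
have := H (upd x j (p 0 j)).
rewrite /X /= => /(_ _ _ (x 0 j)); rewrite upd_upd upd_id; apply.
- move=> i ni; have := xc i (ltnW ni); rewrite !updE.
  have ij : i == j = false by apply/negP => /eqP ij; rewrite ij ltnn in ni.
  by rewrite ij lt_min => /andP[].
- move=> i ni; rewrite updE; case: eqP => [->//|/eqP ij].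
  by apply: xp; rewrite ltn_neqAle ni eq_sym ij.
- by have := xc j (ltnSn n); rewrite updE eqxx lt_min => /andP[].
Qed.

(* The Baire property of the cross topology: the proof removes one coordinate
   at a time, each removal being the Baire theorem on the line. *)
Lemma sep_baire (F : nat -> set 'rV[R]_d) W :
  sep_open W -> W !=set0 -> (forall k, sep_closed (F k)) ->
  (forall x, W x -> exists k, F k x) ->
  exists k c r, 0 < r /\ box c r `<=` F k.
Proof.
move=> oW [p Wp] cF cov.
have [||||k [c [r [r0 H]]]] := @sep_baire_slice d nat F W p.
- by move=> x i _; exact: oW.
- by move=> k x i _; exact: cF.
- by [].
- by move=> x /cov.
exists k, c, r; split => // x xc; apply: H => // j.
by rewrite leqNgt ltn_ord.
Qed.

(** This is the Euclidean closure; as the Euclidean topology is coarser than the cross topology, it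
    is in particular closed on axis lines. *)
Definition box_closure W : set 'rV[R]_d :=
  [set x | forall e, 0 < e -> exists2 y, W y & box x e y].

Lemma box_closure_closed W : sep_closed (box_closure W).
Proof.
move=> x i t clt e e0.
have e20 : 0 < e / 2 by lra.
have [t' [/= Wt' tt']] := clt _ (nbhsx_ballx t (e / 2) e20).
have [y Wy yt'] := Wt' _ e20.
exists y => // j; have := yt' j; move: tt'; rewrite /ball /= !updE.
case: eqP => _ tt' ytj; last by lra.
rewrite (_ : y 0 j - t = (y 0 j - t') + (t' - t)); last by ring.
rewrite (le_lt_trans (ler_normD _ _))// [ltRHS](splitr e) ltrD//.
by rewrite distrC.
Qed.

Lemma sub_box_closure W : W `<=` box_closure W.
Proof. by move=> x Wx e e0; exists x => // i; rewrite subrr normr0. Qed.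

Lemma box_center c r : 0 < r -> box c r c.
Proof. by move=> r0 i; rewrite subrr normr0. Qed.

Lemma sep_closedI F1 F2 :
  sep_closed F1 -> sep_closed F2 -> sep_closed (F1 `&` F2).
Proof. by move=> c1 c2 x i; exact: closedI (c1 x i) (c2 x i). Qed.

Lemma sep_openI F1 F2 : sep_open F1 -> sep_open F2 -> sep_open (F1 `&` F2).
Proof. by move=> c1 c2 x i; exact: openI (c1 x i) (c2 x i). Qed.

Lemma sep_openC F : sep_closed F -> sep_open (~` F).
Proof. by move=> cF x i; exact: closed_openC (cF x i). Qed.

Lemma box_inner c r x : box c r x -> exists2 e, 0 < e & box x e `<=` box c r.
Proof.
move=> xc.
have [e e0 H] : exists2 e, 0 < e & forall i, e <= r - `|x 0 i - c 0 i|.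
  have [/eqP d0|d0] := boolP (d == 0)%N.
    by exists 1 => // i; exfalso; case: i => i; rewrite d0.
  have i0 : 'I_d by case: d d0 {xc c x} => // n _; exact: ord0.
  exists (\big[Num.min/(r - `|x 0 i0 - c 0 i0|)]_i (r - `|x 0 i - c 0 i|)).
    elim/big_ind : _ => [||i _]; rewrite ?subr_gt0; [exact: xc | | exact: xc].
    by move=> u v u0 v0; rewrite lt_min u0.
  by move=> i; rewrite (bigD1 i)//= ge_min lexx.
exists e => // y yx i.
rewrite (_ : y 0 i - c 0 i = (y 0 i - x 0 i) + (x 0 i - c 0 i)); last by ring.
have := H i; have := yx i; have := ler_normD (y 0 i - x 0 i) (x 0 i - c 0 i).
by lra.
Qed.

Lemma box_le c r s : r <= s -> box c r `<=` box c s.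
Proof. by move=> rs x xc i; exact: lt_le_trans (xc i) rs. Qed.

Lemma sep_open_box c r : sep_open (box c r).
Proof.
move=> x i; rewrite openE => t /= /box_inner[e e0 H]; rewrite /interior.
exists e => // s ts; apply: H => j; rewrite !updE.
by case: eqP => _; rewrite ?subrr ?normr0 // distrC.
Qed.

(* Localising the Baire property to [W]: the box found may be chosen to meet
   [W], because [W] is also covered by the traces of the [F k] on its closure. *)
Lemma sep_baire_meet (F : nat -> set 'rV[R]_d) W :
  sep_open W -> W !=set0 -> (forall k, sep_closed (F k)) ->
  (forall x, exists k, F k x) ->
  exists k x r, [/\ W x, 0 < r & box x r `<=` F k].
Proof.
move=> oW W0 cF cov.
have [|x Wx|k [c [r [r0 H]]]] :=
  @sep_baire (fun k => F k `&` box_closure W) W oW W0.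
- by move=> k; apply: sep_closedI => //; exact: box_closure_closed.
- by have [k Fk] := cov x; exists k; split => //; exact: sub_box_closure.
have [_ /(_ r r0)[x Wx xc]] := H c (box_center c r0).
have [e e0 He] := box_inner xc.
by exists k, x, e; split => // y /He /H[].
Qed.

End CrossTopology.

(** * Partially derivable maps *)

Section NearLinear.
Context {R : realType}.

Lemma rV_coord_le n (x : 'rV[R]_n) i : `|x 0 i| <= `|x|.
Proof.
by rewrite /Num.norm /= mx_normrE; apply: (le_bigmax _ _ (0, i)).
Qed.

Lemma rV_norm_le n (x : 'rV[R]_n) e :
  0 <= e -> (forall i, `|x 0 i| <= e) -> `|x| <= e.
Proof.
move=> e0 xe; rewrite /Num.norm /= mx_normrE.
by apply: bigmax_le => // -[i j] _ /=; rewrite ord1.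
Qed.

Lemma rV_mulmx_le m n (B : 'M[R]_(m, n)) :
  exists2 K, 0 < K & forall v : 'rV_m, `|v *m B| <= K * `|v|.
Proof.
pose K := \sum_i \sum_j `|B i j|.
have K0 : 0 <= K by apply: sumr_ge0 => i _; apply: sumr_ge0.
exists (K + 1) => [|v]; first lra.
apply: (@le_trans _ _ (K * `|v|)); last by apply: ler_wpM2r => //; lra.
apply: rV_norm_le => [|j]; first exact: mulr_ge0.
rewrite mxE (le_trans (ler_norm_sum _ _ _))// mulr_suml ler_sum// => i _.
rewrite normrM mulrC ler_pM// ?rV_coord_le//.
by rewrite (bigD1 j)//= lerDl sumr_ge0.
Qed.

(** The difference quotient is multiplied out so that [s = 0] is allowed. *)
Lemma derivable_approx (V W : normedModType R) (f : V -> W) x v e :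
  derivable f x v -> 0 < e ->
  exists2 del, 0 < del & forall s : R, `|s| <= del ->
    `|f (s *: v + x) - f x - s *: 'D_v f x| <= e * `|s|.
Proof.
move=> df e0.
have /cvgrPdist_le /(_ e e0) := df.
rewrite near_withinE => /nbhs_ballP[del /= del0 H].
exists (del / 2) => [|s sd]; first lra.
have [->|s0] := eqVneq s 0; first by rewrite !scale0r add0r !subrr !normr0 mulr0.
have : `|'D_v f x - s^-1 *: (f (s *: v + x) - f x)| <= e.
  by apply: H => //; rewrite /ball /= sub0r normrN; lra.
rewrite -(ler_pM2r (x := `|s|)) ?normr_gt0// => H1; apply: le_trans H1.
rewrite mulrC -normrZ scalerBr scalerA divff// scale1r distrC.
by rewrite opprB addrC.
Qed.

Lemma fin_unif_nat n (P : 'I_n -> nat -> Prop) :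
  (forall i (k l : nat), (k <= l)%N -> P i k -> P i l) ->
  (forall i, exists k, P i k) -> exists k, forall i, P i k.
Proof.
move=> mono /fin_all_exists[f Pf]; exists (\max_i f i) => i.
exact: mono (leq_bigmax i) (Pf i).
Qed.

Lemma natSinv_lt (e : R) : 0 < e -> exists n : nat, n.+1%:R^-1 < e.
Proof.
move=> e0; have := @near_infty_natSinv_lt R (PosNum e0).
by move=> -[m _ /(_ m (leqnn m))]; exists m.
Qed.

Lemma natSinv_le (k l : nat) : (k <= l)%N -> l.+1%:R^-1 <= k.+1%:R^-1 :> R.
Proof. by move=> kl; rewrite lef_pV2 ?posrE ?ltr0Sn// ler_nat ltnS. Qed.

Variable d : nat.
Implicit Types (g h : 'rV[R]_d -> 'rV[R]_d) (x y c : 'rV[R]_d) (i j : 'I_d).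

Definition partially_derivable g := forall x i, derivable g x (ebasis R i).

Definition sep_continuous (V : topologicalType) (g : 'rV[R]_d -> V) :=
  forall x i, continuous (fun t : R => g (upd x i t)).

Lemma derive_line (W : normedModType R) (g : 'rV[R]_d -> W) x i t :
  (derivable g (upd x i t) (ebasis R i) ->
    derivable (fun s : R => g (upd x i s)) t 1) *
  ('D_1 (fun s : R => g (upd x i s)) t = 'D_(ebasis R i) g (upd x i t)).
Proof.
suff E : (fun h : R => h^-1 *: (((fun s : R => g (upd x i s)) \o shift t)
    (h *: 1) - g (upd x i t))) =
  (fun h : R => h^-1 *: ((g \o shift (upd x i t)) (h *: ebasis R i) -
    g (upd x i t))).
  by split; rewrite /derivable /derive E.
apply/funext => h /=; rewrite -upd_shift upd_upd updE eqxx.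
by rewrite [h *: 1]mulr1 (addrC h).
Qed.

Lemma partially_derivable_sep g : partially_derivable g -> sep_continuous g.
Proof.
move=> dg x i t; apply: differentiable_continuous.
apply/derivable1_diffP; exact: (derive_line g x i t).1 (dg _ _).
Qed.

Lemma sep_continuous_translate (V : topologicalType) (g : 'rV[R]_d -> V) v :
  sep_continuous g -> sep_continuous (fun x => g (v + x)).
Proof.
move=> cg x i t.
have -> : (fun t => g (v + upd x i t)) =
    (fun t => g (upd (x + v) i t)) \o (fun t => t + v 0 i).
  by apply/funext => s /=; rewrite (addrC v) upd_add.
apply: continuous_comp; last exact: cg.
by apply: continuousD => //; exact: cst_continuous.
Qed.

Lemma sep_closed_le (V : normedModType R) (phi : 'rV[R]_d -> V) (e : R) :
  sep_continuous phi -> sep_closed [set x | `|phi x| <= e].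
Proof.
move=> cphi x i.
apply: (@preimage_closed _ _ (fun t => `|phi (upd x i t)|) [set u | u <= e]).
  move=> t _; apply: (continuous_comp (cphi x i t)); exact: norm_continuous.
exact: closed_le.
Qed.

Lemma sep_closed_forall (I : Type) (F : I -> set 'rV[R]_d) (D : set I) :
  (forall k, D k -> sep_closed (F k)) -> sep_closed [set x | forall k, D k -> F k x].
Proof.
move=> cF x i.
rewrite (_ : [set t | _] = \bigcap_(k in D) [set t | F k (upd x i t)]) //.
by apply: closed_bigI => k Dk; exact: cF.
Qed.

(** For [A = 0] this is a Lipschitz bound with constant [e] along the axes. Row [i] of [A] stands
    for the [i]-th partial derivative, so [A] plays the role of a transposed Jacobian matrix. *)
Definition near_lin g c r (A : 'M[R]_d) e := forall x i s,
  box c r x -> box c r (s *: ebasis R i + x) ->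
  `|g (s *: ebasis R i + x) - g x - s *: row i A| <= e * `|s|.

Lemma ebasis_mulmx s i (A : 'M[R]_d) : (s *: ebasis R i) *m A = s *: row i A.
Proof. by rewrite -scalemxAl -rowE. Qed.

(** The axis estimates add up along the path from [x] to [y] that changes one coordinate at a time
    and stays in the box; [hyb n] is its [n]-th vertex. *)
Lemma near_lin_sum g c r A e x y : near_lin g c r A e ->
  box c r x -> box c r y ->
  `|g y - g x - (y - x) *m A| <= e * \sum_i `|y 0 i - x 0 i|.
Proof.
move=> gA cx cy.
pose hyb n : 'rV[R]_d := \row_j (if (j < n)%N then y 0 j else x 0 j).
have hybbox n : box c r (hyb n).
  by move=> i; rewrite mxE; case: ifP => _; [exact: cy|exact: cx].
have H n : `|g (hyb n) - g x - (hyb n - x) *m A| <=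
    e * \sum_(i < d | (i < n)%N) `|y 0 i - x 0 i|.
  elim: n => [|n IH].
    rewrite big1 ?mulr0 ?normr_le0; last by [].
    have -> : hyb 0%N = x by apply/rowP => j; rewrite mxE ltn0.
    by rewrite !subrr mul0mx subr0.
  have [nd|dn] := ltnP n d; last first.
    have E i : (i < n.+1)%N = (i < n)%N.
      rewrite ltnS (leq_trans (ltn_ord i) dn).
      by apply/ltnW; rewrite (leq_trans (ltn_ord i) dn).
    have -> : hyb n.+1 = hyb n by apply/rowP => j; rewrite !mxE E.
    by rewrite (eq_bigl (fun i : 'I_d => (i < n)%N)).
  pose j := Ordinal nd.
  have E : hyb n.+1 = (y 0 j - x 0 j) *: ebasis R j + hyb n.
    rewrite (_ : y 0 j - x 0 j = y 0 j - hyb n 0 j); last by rewrite mxE ltnn.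
    rewrite -upd_shift addrC; rewrite subrK.
    apply/rowP => k; rewrite updE !mxE ltnS leq_eqVlt.
    have [->|kj] := eqVneq k j; first by rewrite /= eqxx.
    by rewrite -[(k == n :> nat)]/(val k == val j) (inj_eq val_inj) (negPf kj).
  rewrite (bigD1 j)//= mulrDr (eq_bigl (fun i : 'I_d => (i < n)%N)); last first.
    move=> i; rewrite ltnS [RHS]ltn_neqAle andbC.
    by rewrite -(inj_eq val_inj).
  have := gA (hyb n) j (y 0 j - x 0 j) (hybbox n); rewrite -E => /(_ (hybbox _)).
  move=> H1; apply: le_trans (lerD H1 IH).
  apply: le_trans (ler_normD _ _); rewrite le_eqVlt; apply/orP; left.
  apply/eqP; congr (`| _ |).
  rewrite {2}E -[X in X *m A]addrA mulmxDl ebasis_mulmx.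
  move: (g (hyb n.+1)) (g (hyb n)) (_ *: row _ _) (_ *m A) (g x) => a b u v w.
  by apply/rowP => k; rewrite !mxE; ring.
have := H d.
rewrite (eq_bigl predT); last by move=> i; rewrite ltn_ord.
by have -> : hyb d = y by apply/rowP => j; rewrite mxE ltn_ord.
Qed.

Lemma near_lin_norm g c r A e x y : 0 <= e -> near_lin g c r A e ->
  box c r x -> box c r y ->
  `|g y - g x - (y - x) *m A| <= e * d%:R * `|y - x|.
Proof.
move=> e0 gA cx cy; apply: (le_trans (near_lin_sum gA cx cy)).
rewrite -mulrA ler_wpM2l// mulr_natl.
rewrite -[X in _ *+ X](card_ord d) -sumr_const ler_sum// => i _.
by have := rV_coord_le (y - x) i; rewrite !mxE.
Qed.

Lemma near_lin_box g c r c' r' A e : box c' r' `<=` box c r ->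
  near_lin g c r A e -> near_lin g c' r' A e.
Proof. by move=> sub gA x i s /sub cx /sub cy; exact: gA. Qed.

Lemma box_step c r x i s :
  box c r x -> box c r (s *: ebasis R i + x) -> `|s| <= 2 * r.
Proof.
move=> /(_ i) + /(_ i); rewrite !mxE !eqxx mulr1.
move: (x 0 i) (c 0 i) => u v; rewrite !ltr_norml ler_norml.
by move=> /andP[? ?] /andP[? ?]; apply/andP; split; lra.
Qed.

Lemma step_box c r x i s : box c r x -> `|s| <= r ->
  box c (2 * r) (s *: ebasis R i + x).
Proof.
move=> cx sr j; rewrite !mxE eqxx /=; have := cx j.
have : `|s * (j == i)%:R| <= `|s|.
  by case: eqP => _; rewrite ?mulr1 ?mulr0 ?normr0.
have := ler_normD (s * (j == i)%:R) (x 0 j - c 0 j); rewrite addrA; lra.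
Qed.

(** Partial derivability puts every point into some set where all axis difference quotients with
    steps up to [1/(n+1)] are at most [n+1]. These sets are sep-closed because [g] is
    sep-continuous, so one of them contains a box centred in [W]. *)
Lemma near_lipschitz g W : partially_derivable g -> sep_open W -> W !=set0 ->
  exists x r N, [/\ W x, 0 < r, 0 <= N & near_lin g x r 0 N].
Proof.
move=> dg oW W0.
pose P (n : nat) x i := forall s : R, `|s| <= n.+1%:R^-1 ->
  `|g (s *: ebasis R i + x) - g x| <= n.+1%:R * `|s|.
have [k||n [x [r [Wx r0 H]]]] := @sep_baire_meet R d
    (fun n => [set x | forall i, setT i -> P n x i]) W oW W0.
- apply: sep_closed_forall => i _; apply: sep_closed_forall => s _.
  apply: sep_closed_le => x j t; apply: continuousB; last first.
    exact: partially_derivable_sep.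
  by apply: (@sep_continuous_translate _ g); exact: partially_derivable_sep.
- move=> x.
  suff [n Pn] : exists n, forall i, P n x i by exists n.
  apply: fin_unif_nat => [i k l kl Pk s sl|i].
    apply: (le_trans (Pk s (le_trans sl (natSinv_le kl)))).
    by rewrite ler_wpM2r// ler_nat.
  have [del del0 H] := derivable_approx (dg x i) (@ltr01 R).
  have [m mdel] := natSinv_lt del0.
  have [q qD] : exists q : nat, `|'D_(ebasis R i) g x| <= q%:R.
    exists (Num.bound `|'D_(ebasis R i) g x|).
    exact/ltW/archi_boundP.
  (* The summand [m] makes the steps small enough for an error [1 * |s|], and [q] bounds the
     derivative. *)
  exists (m + q)%N => s sl.
  have sd : `|s| <= del.
    apply: (le_trans sl); apply/ltW; apply: le_lt_trans mdel.
    by apply: natSinv_le; rewrite leq_addr.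
  have := H s sd => {}H.
  rewrite -[X in `|X|](subrK (s *: 'D_(ebasis R i) g x)).
  apply: (le_trans (ler_normD _ _)); rewrite normrZ [`|s| * _]mulrC.
  apply: (@le_trans _ _ (1 * `|s| + q%:R * `|s|)).
    by apply: lerD => //; rewrite ler_wpM2r.
  by rewrite -mulrDl ler_wpM2r// -natr1 natrD; have := ler0n R m; lra.
have n0 : 0 < n.+1%:R^-1 :> R by rewrite invr_gt0 ltr0Sn.
have {}H y : box x r y -> forall i s, `|s| <= n.+1%:R^-1 ->
  `|g (s *: ebasis R i + y) - g y| <= n.+1%:R * `|s|.
  by move=> ry i s; exact: H.
move: n.+1%:R^-1 n0 H => u u0 H.
(* Two points of a box of radius [u / 2] on one axis line differ by a step of at most [u]. *)
exists x, (Num.min r (u / 2)), n.+1%:R; split => //.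
  by rewrite lt_min r0; lra.
move=> y i s ym sm; rewrite row0 scaler0 subr0; apply: H => //.
  by apply: box_le ym; rewrite ge_min lexx.
have := box_step ym sm.
have : Num.min r (u / 2) <= u / 2 by rewrite ge_min lexx orbT.
lra.
Qed.

End NearLinear.

(** * Near-linearity and nonvanishing of the Jacobian determinant *)

Section Jacobian.
Context {R : realType} {d : nat}.
Implicit Types (g h : 'rV[R]_d -> 'rV[R]_d) (x y c : 'rV[R]_d) (i j : 'I_d).

Lemma near_lin_lipschitz g c r N x y : 0 <= N -> near_lin g c r 0 N ->
  box c r x -> box c r y -> `|g y - g x| <= N * d%:R * `|y - x|.
Proof.
move=> N0 gN cx cy.
by have := near_lin_norm N0 gN cx cy; rewrite mulmx0 subr0.
Qed.

Lemma norm_box c r x : `|x - c| < r -> box c r x.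
Proof.
move=> xc i; apply: le_lt_trans xc.
by have := rV_coord_le (x - c) i; rewrite !mxE.
Qed.

Lemma box_norm c r x : 0 <= r -> box c r x -> `|x - c| <= r.
Proof. by move=> r0 cx; apply: rV_norm_le => // i; rewrite !mxE ltW. Qed.

Lemma near_lin_continuous g r N x : 0 < r -> 0 <= N -> near_lin g x r 0 N ->
  {for x, continuous g}.
Proof.
move=> r0 N0 gN.
apply/(@cvgrPdist_lt _ _ _ (nbhs x) (nbhs_filter x)) => e e0; apply/nbhs_ballP.
have Nd0 : 0 <= N * d%:R by rewrite mulr_ge0.
have q0 : 0 < e / (N * d%:R + 1) by rewrite divr_gt0//; lra.
exists (Num.min r (e / (N * d%:R + 1))) => [|y]; first by rewrite /= lt_min r0.
rewrite -ball_normE /ball_ /= distrC lt_min => /andP[/norm_box xy].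
rewrite ltr_pdivlMr; last lra.
move=> ye; rewrite distrC; apply: le_lt_trans ye.
apply: (le_trans (near_lin_lipschitz N0 gN (box_center _ r0) xy)).
by rewrite mulrDr mulr1 mulrC lerDl.
Qed.

(** Baire gives a box on which axis difference quotients for any two small steps differ by at most
    [e / 2]. All of them are compared with the quotient for one fixed step [s0], which varies by at
    most [e / 2] on a small box since [g] is Lipschitz there; its value at the centre gives the rows
    of [A]. *)
Lemma near_lin_dense g W e : partially_derivable g -> sep_open W ->
  W !=set0 -> 0 < e ->
  exists x r A, [/\ W x, 0 < r & near_lin g x r A e].
Proof.
move=> dg oW W0 e0.
have [x0 [r0 [N [Wx0 r00 N0 gN]]]] := near_lipschitz dg oW W0.
have e20 : 0 < e / 2 by lra.
(* The comparison of the two quotients is multiplied by both steps, which keeps it meaningful for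
   zero steps and sep-closed in [x]. *)
pose P (n : nat) x i := forall ss : R * R,
  `|ss.1| <= n.+1%:R^-1 /\ `|ss.2| <= n.+1%:R^-1 ->
  `|ss.2 *: (g (ss.1 *: ebasis R i + x) - g x) -
    ss.1 *: (g (ss.2 *: ebasis R i + x) - g x)| <= (e / 2) * `|ss.1| * `|ss.2|.
have [||k|x|n [x1 [r1 [[Wx1 bx1] r10 H]]]] := @sep_baire_meet R d
    (fun n => [set x | forall i, setT i -> P n x i]) (W `&` box x0 r0).
- by apply: sep_openI => //; exact: sep_open_box.
- by exists x0; split => //; exact: box_center.
- apply: sep_closed_forall => i _; apply: sep_closed_forall => -[s s'] _ /=.
  have C : forall s, sep_continuous (fun x => g (s *: ebasis R i + x) - g x).
    move=> u x j t; apply: continuousB; last exact: partially_derivable_sep.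
    by apply: (@sep_continuous_translate _ _ _ g); exact: partially_derivable_sep.
  have C1 u v : sep_continuous (fun x => v *: (g (u *: ebasis R i + x) - g x)).
    by move=> x j t; exact: (continuousZl_tmp (C u x j t)).
  apply: sep_closed_le => x j t.
  exact: (continuousB (C1 s s' x j t) (C1 s' s x j t)).
- suff [n Pn] : exists n, forall i, P n x i by exists n.
  apply: fin_unif_nat => [i k l kl Pk ss [s1 s2]|i].
    by apply: Pk; split; [apply: le_trans s1 _|apply: le_trans s2 _];
      exact: natSinv_le.
  have e40 : 0 < e / 4 by lra.
  have [del del0 H] := derivable_approx (dg x i) e40.
  have [m /ltW mdel] := natSinv_lt del0.
  exists m => -[s s'] /= [sm sm'].
  have := H s (le_trans sm mdel); have := H s' (le_trans sm' mdel).
  move: (g (s *: _ + x) - g x) (g (s' *: _ + x) - g x) ('D__ g x) => u v D.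
  move=> Hv Hu.
  rewrite (_ : _ - _ = s' *: (u - s *: D) - s *: (v - s' *: D)); last first.
    by rewrite !scalerBr !scalerA (mulrC s' s) opprB addrA subrK.
  apply: (le_trans (ler_normB _ _)); rewrite !normrZ.
  have := ler_wpM2l (normr_ge0 s') Hu; have := ler_wpM2l (normr_ge0 s) Hv.
  lra.
have n0 : 0 < n.+1%:R^-1 :> R by rewrite invr_gt0 ltr0Sn.
have {}H y : box x1 r1 y -> forall i s s',
    `|s| <= n.+1%:R^-1 -> `|s'| <= n.+1%:R^-1 ->
  `|s' *: (g (s *: ebasis R i + y) - g y) -
    s *: (g (s' *: ebasis R i + y) - g y)| <= (e / 2) * `|s| * `|s'|.
  by move=> ry i s s' ? ?; apply: (H _ ry i _ (s, s')).
move: n.+1%:R^-1 n0 H => {n P}u u0 H.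
have [r2 r20 sub2] := box_inner bx1.
pose rho := Num.min r1 r2.
have rho0 : 0 < rho by rewrite lt_min r10.
pose s0 := Num.min (rho / 2) u.
have s00 : 0 < s0 by rewrite lt_min u0 andbT; lra.
have s0rho : s0 <= rho / 2 by rewrite ge_min lexx.
have s0u : s0 <= u by rewrite ge_min lexx orbT.
pose K := 4 * (N * d%:R + 1).
have Nd0 : 0 <= N * d%:R by rewrite mulr_ge0.
have K0 : 0 < K by rewrite /K; lra.
(* With this radius the increment of [g] over the step [s0] changes by at most [e / 2 * s0] across
   the box. *)
pose r := Num.min s0 (e * s0 / K) / 2.
have eK : 0 < e * s0 / K by rewrite divr_gt0// mulr_gt0.
have m0 : 0 < Num.min s0 (e * s0 / K) by rewrite lt_min s00.
have ms : Num.min s0 (e * s0 / K) <= s0 by rewrite ge_min lexx.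
have mK : Num.min s0 (e * s0 / K) <= e * s0 / K by rewrite ge_min lexx orbT.
have r'0 : 0 < r by rewrite /r; lra.
pose A := \matrix_i (s0^-1 *: (g (s0 *: ebasis R i + x1) - g x1)).
exists x1, r, A; split => //.
have inb y i : box x1 r y -> box x0 r0 y /\ box x0 r0 (s0 *: ebasis R i + y).
  move=> by_; split; apply: sub2; apply: (@box_le _ _ _ rho).
  - by rewrite ge_min lexx orbT.
  - by apply: box_le by_; rewrite /r; lra.
  - by rewrite ge_min lexx orbT.
  - rewrite [rho](_ : _ = 2 * (rho / 2)); last lra.
    apply: step_box; first by apply: box_le by_; rewrite /r; lra.
    by rewrite gtr0_norm.
move=> y i s by_ bsy.
have by1 : box x1 r1 y.
  apply: box_le by_; apply: (@le_trans _ _ rho); first by rewrite /r; lra.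
  by rewrite ge_min lexx.
have su : `|s| <= u by have := box_step by_ bsy; rewrite /r; lra.
have := H y by1 i s s0 su; rewrite (gtr0_norm s00) => /(_ s0u) H1.
have [b1 b2] := inb _ i by_; have [b3 b4] := inb _ i (box_center x1 r'0).
have L1 := near_lin_lipschitz N0 gN b3 b1.
have := near_lin_lipschitz N0 gN b4 b2.
rewrite opprD addrACA subrr add0r => L2.
have yx := box_norm (ltW r'0) by_.
rewrite rowK scalerA.
rewrite -(ler_pM2l s00) -{1}(gtr0_norm s00) -normrZ.
have Hw : `|(g (s0 *: ebasis R i + y) - g y) - (g (s0 *: ebasis R i + x1) - g x1)|
   <= e / 2 * s0.
  rewrite [X in `|X|](_ : _ = (g (s0 *: ebasis R i + y) - g (s0 *: ebasis R i + x1))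
     - (g y - g x1)); last first.
    by apply/rowP => k; rewrite !mxE; ring.
  apply: (le_trans (ler_normB _ _)).
  apply: (@le_trans _ _ (2 * (N * d%:R * r))).
    have := ler_wpM2l Nd0 yx; lra.
  have : K * r <= e * s0 / 2.
    have : K * (e * s0 / K) = e * s0 by rewrite mulrC divfK// gt_eqF.
    have := ler_wpM2l (ltW K0) mK; rewrite /r; lra.
  by rewrite /K; have := mulr_gt0 e0 s00; have := r'0; clearbody r; lra.
move: H1 Hw.
move: (g (s *: _ + y) - g y) (g (s0 *: _ + y) - g y) (g (s0 *: _ + x1) - g x1).
move=> a w w1 H1 Hw.
rewrite scalerBr scalerA mulrCA divff ?gt_eqF// mulr1.
rewrite (_ : _ - _ = (s0 *: a - s *: w) + s *: (w - w1)); last first.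
  by rewrite scalerBr addrA subrK.
apply: (le_trans (ler_normD _ _)); rewrite normrZ.
by have := ler_wpM2l (normr_ge0 s) Hw; lra.
Qed.

(** A vector [v] killed by [M] satisfies [v = v *m (1%:M - M)], whose norm is at most [n * rho]
    times that of [v]; hence [v = 0]. *)
Lemma unitmx_near1 n (M : 'M[R]_n) (rho : R) : n%:R * rho < 1 ->
  (forall k l, `|(1%:M - M) k l| <= rho) -> M \in unitmx.
Proof.
move=> nrho HM; rewrite -row_free_unit; apply: inj_row_free => v vM.
have vE : v = v *m (1%:M - M) by rewrite mulmxBr mulmx1 vM subr0.
apply/eqP; rewrite -normr_eq0 -[_ == 0]negbK; apply/negP => v0.
have {}v0 : 0 < `|v| by rewrite lt_def v0/=.
suff : `|v| <= (n%:R * rho) * `|v| by rewrite -[X in X <= _]mul1r ler_pM2r//; lra.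
have [n0|n0] := posnP n.
  have : `|v| <= 0 by apply: rV_norm_le => // -[m mn]; exfalso; rewrite n0 in mn.
  by rewrite leNgt v0.
have rho0 : 0 <= rho.
  by apply: le_trans (normr_ge0 _) (HM (Ordinal n0) (Ordinal n0)).
apply: rV_norm_le => [|j]; first by rewrite !mulr_ge0.
rewrite {1}vE mxE (le_trans (ler_norm_sum _ _ _))//.
rewrite -mulrA mulr_natl -[X in _ *+ X](card_ord n) -sumr_const ler_sum// => i _.
by rewrite normrM mulrC ler_pM // rV_coord_le.
Qed.

Lemma row_jacobianT g x i : row i (jacobian g x)^T = 'D_(ebasis R i) g x.
Proof. by apply/rowP => j; rewrite !mxE. Qed.

(** Linearising [h (g y) - h (g x) = y - x] for a short axis step shows that the transposed Jacobian
    matrix of [g] times [B] is close to the identity. Neither a derivative of [h] at [g x] nor full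
    differentiability of [g] at [x] enters. *)
Lemma jacobian_nonsingular g h x r1 r2 N e B :
  cancel g h -> (forall i, derivable g x (ebasis R i)) ->
  0 < r1 -> 0 < r2 -> 0 <= N -> 0 <= e ->
  near_lin g x r1 0 N -> near_lin h (g x) r2 B e ->
  e * d%:R * N <= (4 * (d%:R + 1))^-1 ->
  \det (jacobian g x) != 0.
Proof.
move=> gK dg r10 r20 N0 e0 gN hB small.
have [K K0 HK] := rV_mulmx_le B.
have D0 : 0 < (4 * (d%:R + 1))^-1 :> R.
  by rewrite invr_gt0; have := ler0n R d; lra.
set D := (4 * (d%:R + 1))^-1 in small D0.
pose eta := D / K.
have eta0 : 0 < eta by rewrite divr_gt0.
have E i : `|ebasis R i - 'D_(ebasis R i) g x *m B| <= 2 * D.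
  have [del del0 H] := derivable_approx (dg i) eta0.
  (* The three bounds keep [y] in the box of [g], make the derivative estimate valid, and keep [g y]
     in the box of [h]. *)
  pose s := Num.min (Num.min (r1 / 2) del) (r2 / (N + 1)).
  have s0 : 0 < s.
    by rewrite !lt_min del0 !divr_gt0//; lra.
  have s1 : s <= r1 / 2 by rewrite !ge_min lexx.
  have s2 : s <= del by rewrite !ge_min lexx orbT.
  have s3 : s * (N + 1) <= r2.
    by rewrite -ler_pdivlMr; [rewrite !ge_min lexx !orbT|lra].
  pose y := s *: ebasis R i + x.
  have xx : box x r1 x by exact: box_center.
  have xy : box x r1 y.
    rewrite [r1](_ : _ = 2 * (r1 / 2)); last lra.
    by apply: step_box; [apply: box_center; lra|rewrite gtr0_norm].
  have gyx : `|g y - g x| <= N * s.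
    have := gN x i s xx xy; rewrite row0 scaler0 subr0 (gtr0_norm s0).
    exact.
  have gxy : box (g x) r2 (g y).
    by apply: norm_box; apply: le_lt_trans gyx _; lra.
  have := near_lin_norm e0 hB (box_center _ r20) gxy.
  rewrite !gK addrK => H1.
  have := H s; rewrite (gtr0_norm s0) => /(_ s2) => H2.
  have {}H2 := le_trans (HK _) (ler_wpM2l (ltW K0) H2).
  have {}H1 := le_trans H1 (ler_wpM2l (mulr_ge0 e0 (ler0n _ d)) gyx).
  rewrite -(ler_pM2l s0) -{1}(gtr0_norm s0) -normrZ scalerBr scalemxAl.
  rewrite (_ : _ - _ = (s *: ebasis R i - (g y - g x) *m B) +
      (g y - g x - s *: 'D_(ebasis R i) g x) *m B); last first.
    by rewrite (mulmxBl (g y - g x)) addrA subrK.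
  apply: (le_trans (ler_normD _ _)); apply: (le_trans (lerD H1 H2)).
  rewrite mulrA (_ : K * (eta * s) = D * s); last first.
    by rewrite mulrA (mulrC K) /eta divfK ?gt_eqF.
  by have := ler_wpM2r (ltW s0) small; lra.
have : (jacobian g x)^T *m B \in unitmx.
  apply: (@unitmx_near1 _ _ (2 * D)) => [|i j].
    have : D * (4 * (d%:R + 1)) = 1.
      by rewrite mulVf// gt_eqF//; have := ler0n R d; lra.
    by move: D0; clear; move: D d%:R => a b; lra.
  apply: le_trans (E i); apply: le_trans (rV_coord_le _ j).
  rewrite le_eqVlt; apply/orP; left; apply/eqP; congr (`| _ |).
  rewrite -row_jacobianT -row_mul !mxE; congr (_ - _).
  by rewrite eqxx eq_sym.
by rewrite unitmx_mul => /andP[]; rewrite unitmxE det_tr unitfE.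
Qed.

(* Only separate continuity of [h] makes [g (box c r)] open in the cross
   topology; this replaces invariance of domain. *)
Lemma jacobian_nonsingular_dense g h c r : cancel g h -> cancel h g ->
  partially_derivable g -> partially_derivable h -> 0 < r ->
  exists2 x, box c r x & \det (jacobian g x) != 0.
Proof.
move=> gK hK dg dh r0.
have [||x1 [r1 [N [cx1 r10 N0 gN]]]] := @near_lipschitz _ _ g (box c r) dg.
- exact: sep_open_box.
- by exists c; exact: box_center.
(* This is the image of the two boxes under [g], written as a preimage under [h] so that separate
   continuity of [h] makes it sep-open. *)
pose W := [set z | (box c r `&` box x1 r1) (h z)].
have oW : sep_open W.
  move=> z i; rewrite openE => t /= [/box_inner[a a0 Ha] /box_inner[b b0 Hb]].
  have ab0 : 0 < Num.min a b by rewrite lt_min a0.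
  have : {for t, continuous (fun s => h (upd z i s))}.
    exact: partially_derivable_sep.
  move=> /cvgrPdist_lt /(_ _ ab0).
  apply: filterS => s; rewrite distrC lt_min => /andP[/norm_box ha /norm_box hb].
  by split; [exact: Ha|exact: Hb].
pose D : R := (4 * (d%:R + 1))^-1.
have D0 : 0 < D by rewrite /D invr_gt0; have := ler0n R d; lra.
(* The precision asked of [h] depends on the Lipschitz constant [N] of [g], which therefore had to
   be fixed first. *)
pose e := D / (d%:R * N + 1).
have dN0 : 0 <= d%:R * N by rewrite mulr_ge0.
have e0 : 0 < e by rewrite divr_gt0//; lra.
have [|z [r2 [B [[Wz1 Wz2] r20 hB]]]] := @near_lin_dense h W e dh oW _ e0.
  by exists (g x1); rewrite /W /= gK; split => //; exact: box_center.
exists (h z) => //.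
have [b b0 Hb] := box_inner Wz2.
apply: (jacobian_nonsingular gK (dg _) b0 r20 N0 (ltW e0)).
- exact: near_lin_box Hb gN.
- by rewrite hK; exact: hB.
- rewrite -/D -mulrA mulrAC ler_pdivrMr; last lra.
  by apply: ler_wpM2l; lra.
Qed.

(** The set where the equality fails is sep-open. If it were nonempty, it would contain a point near
    which [g1] and [g2] are both Lipschitz; there the failure would persist on a Euclidean
    neighbourhood, which meets [P]. *)
Lemma sep_dense_eq (g1 g2 : 'rV[R]_d -> 'rV[R]_d) (u v : 'rV[R]_d -> R)
  (P : set 'rV[R]_d) :
  partially_derivable g1 -> partially_derivable g2 ->
  continuous u -> continuous v ->
  (forall c r, 0 < r -> exists2 x, box c r x & P x) ->
  (forall x, P x -> u (g1 x) = v (g2 x)) -> forall x, u (g1 x) = v (g2 x).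
Proof.
move=> dg1 dg2 cu cv dense uvP x0; apply: contrapT => neq.
pose W := ~` [set x | `|(u (g1 x) - v (g2 x) : R^o)| <= 0].
have WP x : W x <-> u (g1 x) <> v (g2 x).
  by rewrite /W /= normr_le0 subr_eq0; split=> H /eqP.
have oW : sep_open W.
  apply: sep_openC; apply: sep_closed_le => x i t.
  have c1 : {for t, continuous (fun t => u (g1 (upd x i t)))}.
    apply: (@continuous_comp _ _ _ (fun t => g1 (upd x i t)) u); last exact: cu.
    exact: partially_derivable_sep.
  have c2 : {for t, continuous (fun t => v (g2 (upd x i t)))}.
    apply: (@continuous_comp _ _ _ (fun t => g2 (upd x i t)) v); last exact: cv.
    exact: partially_derivable_sep.
  exact: continuousB c1 c2.
have W0 : W !=set0 by exists x0; apply/WP.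
have [x1 [r1 [N1 [Wx1 r10 N10 gN1]]]] := near_lipschitz dg1 oW W0.
have [||x2 [r2 [N2 [[Wx2 bx2] r20 N20 gN2]]]] :=
  near_lipschitz dg2 (W := W `&` box x1 r1).
- by apply: sep_openI => //; exact: sep_open_box.
- by exists x1; split => //; exact: box_center.
have [r3 r30 sub] := box_inner bx2.
have c1 := near_lin_continuous r30 N10 (near_lin_box sub gN1).
have c2 := near_lin_continuous r20 N20 gN2.
have cu1 : {for x2, continuous (u \o g1)} by apply: continuous_comp c1 _; exact: cu.
have cv2 : {for x2, continuous (v \o g2)} by apply: continuous_comp c2 _; exact: cv.
have cuv := continuousB cu1 cv2.
have e0 : 0 < `|u (g1 x2) - v (g2 x2)|.
  by rewrite normr_gt0 subr_eq0; apply/eqP/WP.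
have /(@cvgrPdist_lt _ _ _ (nbhs x2) (nbhs_filter x2))/(_ _ e0) := cuv.
move=> /nbhs_ballP[r /= r0 H].
have [x bx Px] := dense x2 (r / 2) (divr_gt0 r0 (ltr0n _ 2)).
have /H : ball x2 r x.
  rewrite -ball_normE /ball_ /= distrC; apply: (@le_lt_trans _ _ (r / 2)); last lra.
  by apply: box_norm bx; lra.
move=> lt; have : `|u (g1 x2) - v (g2 x2) - (u (g1 x) - v (g2 x))| <
    `|u (g1 x2) - v (g2 x2)| by exact: lt.
by rewrite (uvP x Px) (subrr (v (g2 x))) subr0 ltxx.
Qed.

End Jacobian.

(** * C^1 functions and curves *)

Section OneVariable.
Context {R : realType}.

Lemma norm_le_MVT (f df : R -> R) (a b e : R) :
  (forall t, is_derive t (1 : R) f (df t)) ->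
  (forall t, Num.min a b <= t <= Num.max a b -> `|df t| <= e) ->
  `|f b - f a| <= e * `|b - a|.
Proof.
move=> Df.
wlog ab : a b / a <= b => [H|] dfe.
  have [ab|/ltW ba] := leP a b; first exact: H.
  by rewrite distrC [`|b - a|]distrC H// => t; rewrite minC maxC; exact: dfe.
have [|c cab ->] := @MVT_segment R f df a b ab (fun x _ => Df x).
  apply: derivable_within_continuous => x _; exact: ex_derive.
rewrite normrM ler_wpM2r//; apply: dfe.
by move: cab; rewrite in_itv /= min_l// max_r.
Qed.

Lemma is_derive_sub_linear (p : R -> R) (t dp c : R) :
  is_derive t (1 : R) p dp ->
  is_derive t (1 : R) (fun t => p t - t * c) (dp - c).
Proof.
move=> D1; have D2 : is_derive t (1 : R) (fun t => t * c) c.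
  have -> : (fun t : R => t * c) = c \*: id.
    by apply/funext => u /=; rewrite mulrC.
  have := @is_deriveZ R R R id c t 1 1 (is_derive_id t 1).
  by rewrite [_ *: 1]mulr1.
exact: is_deriveB D1 D2.
Qed.

(** Strict differentiability: the mean value inequality applied to [p] minus its linear part at
    [a]. *)
Lemma C1_strict (p : R -> R) (a e : R) : (forall t, derivable p t 1) ->
  {for a, continuous (derive1 p)} -> 0 < e ->
  exists2 del, 0 < del & forall s s', `|s - a| < del -> `|s' - a| < del ->
    `|p s' - p s - (s' - s) * (derive1 p) a| <= e * `|s' - s|.
Proof.
move=> dp /cvgrPdist_le /(_ e) cp e0.
have /nbhs_ballP[del /= del0 H] := cp e0.
exists del => // s s' sa sa'.
have D t : is_derive t (1 : R) (fun t => p t - t * derive1 p a)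
    (derive1 p t - derive1 p a).
  by apply: is_derive_sub_linear; rewrite derive1E; exact/derivableP/dp.
have := norm_le_MVT (a := s) (b := s') (e := e) D.
rewrite (_ : _ - _ - (_ - _) = p s' - p s - (s' - s) * (derive1 p) a); last by ring.
apply => t /andP[t1 t2]; rewrite distrC; apply: H; rewrite /ball /= distrC.
move: sa sa'; rewrite !ltr_norml => /andP[? ?] /andP[? ?].
move: t1 t2; rewrite ge_min le_max => /orP[] ? /orP[] ?; apply/andP; split; lra.
Qed.

Lemma C1_lipschitz (g : R -> R) (N : R) : (forall t, derivable g t 1) ->
  continuous (derive1 g) ->
  exists2 L, 0 < L & forall u v, `|u| <= N -> `|v| <= N ->
    `|g v - g u| <= L * `|v - u|.
Proof.
move=> dg cg.
have [N0|N0] := ltP N 0.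
  exists 1 => // u v uN; have := normr_ge0 u; lra.
have [||c _ cmax] := @EVT_max R (fun t => `|(derive1 g) t|) (- N) N; first lra.
  apply: continuous_subspaceT => t.
  by apply: continuous_comp; [exact: cg|exact: norm_continuous].
exists (`|(derive1 g) c| + 1) => [|u v uN vN].
  by have := normr_ge0 ((derive1 g) c); lra.
apply: (@norm_le_MVT g (derive1 g)) => [t|t /andP[t1 t2]].
  by rewrite derive1E; exact/derivableP/dg.
apply: (@le_trans _ _ `|(derive1 g) c|); last lra.
apply: cmax; rewrite in_itv /=.
move: uN vN; rewrite !ler_norml => /andP[? ?] /andP[? ?].
move: t1 t2; rewrite ge_min le_max => /orP[] ? /orP[] ?; apply/andP; split; lra.
Qed.

(* Pigeonhole: a bounded interval has room for [O(n)] such points only. *)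
Lemma separated_grid_absurd (N c : R) : 0 < c ->
  ~ (forall n : nat, (0 < n)%N -> exists u : 'I_n * 'I_n -> R,
      (forall z, `|u z| <= N) /\
      (forall z z', z != z' -> c / n%:R <= `|u z - u z'|)).
Proof.
move=> c0 H.
have N0 : 0 <= N.
  have [u [uN _]] := H 1%N isT.
  exact: le_trans (normr_ge0 _) (uN (ord0, ord0)).
have b0 : 0 <= 4 * N / c by rewrite divr_ge0 ?(ltW c0)//; lra.
(* Large enough that the [n^2] points outnumber the at most [4 * N * n / c + 1] available integer
   parts. *)
pose n := (Num.bound (4 * N / c)).+3.
have nb : 4 * N / c + 2 < n%:R.
  have := archi_boundP b0; rewrite /n -addn3 natrD; lra.
have n0 : 0 < n%:R :> R by rewrite ltr0n.
have [u [uN usep]] := H n isT.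
(* After this rescaling distinct points are at least 2 apart, so their integer parts differ. *)
pose w z := (u z + N) * (2 * n%:R / c).
have k0 : 0 < 2 * n%:R / c by rewrite divr_gt0//; lra.
have w0 z : 0 <= w z.
  rewrite mulr_ge0// ?(ltW k0)//; have := uN z; rewrite ler_norml => /andP[]; lra.
pose m := (Num.truncn (4 * N / c * n%:R)).+1.
have wm z : (Num.truncn (w z) < m)%N.
  rewrite ltnS; apply: le_truncn.
  have uz : u z + N <= 2 * N by have := uN z; rewrite ler_norml => /andP[]; lra.
  apply: (le_trans (ler_wpM2r (ltW k0) uz)).
  by rewrite le_eqVlt; apply/orP; left; apply/eqP; field; rewrite gt_eqF.
have finj : injective (fun z => Ordinal (wm z)).
  move=> z z' [fz]; apply/eqP/negPn/negP => zz'.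
  have := truncn_itv (w0 z); have := truncn_itv (w0 z'); rewrite fz -natr1.
  move=> /andP[a1 a2] /andP[a3 a4].
  have : `|w z - w z'| < 1 by rewrite ltr_norml; apply/andP; split; lra.
  rewrite (_ : w z - w z' = (u z - u z') * (2 * n%:R / c)); last first.
    by rewrite /w; ring.
  rewrite normrM (gtr0_norm k0); have := ler_wpM2r (ltW k0) (usep _ _ zz').
  rewrite (_ : c / n%:R * (2 * n%:R / c) = 2); first lra.
  by field; rewrite !gt_eqF.
have := leq_card _ finj.
rewrite card_prod !card_ord -(ler_nat R) natrM /m -natr1.
have w00 : 0 <= 4 * N / c * n%:R by rewrite mulr_ge0// ltW.
have := truncn_itv w00 => /andP[t1 _].
have := ltr_pM2l n0 (4 * N / c + 2) n%:R; rewrite nb mulrDr.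
have n1 : 1 <= n%:R :> R by rewrite ler1n.
lra.
Qed.

End OneVariable.

Section SeveralVariables.
Context {R : realType} {d : nat}.
Implicit Types (g : 'rV[R]_d -> 'rV[R]_d) (x y : 'rV[R]_d) (i j : 'I_d).

Lemma is_derive_coord_line g x i j t : partially_derivable g ->
  is_derive t (1 : R) (fun s => g (upd x i s) 0 j)
    (('D_(ebasis R i) g (upd x i t)) 0 j).
Proof.
move=> dg; have dG := (derive_line g x i t).1 (dg _ _).
rewrite -(derive_line g x i t).2 derive_mx// mxE.
by apply/derivableP; move/derivable_mxP : dG; exact.
Qed.

(** Mean value inequality on each axis segment, for each coordinate of [g] minus its linear part at
    [x0]. *)
Lemma near_lin_C1 g x0 e : partially_derivable g ->
  (forall i, {for x0, continuous ('D_(ebasis R i) g)}) -> 0 < e ->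
  exists2 r, 0 < r & near_lin g x0 r (jacobian g x0)^T e.
Proof.
move=> dg cg e0.
pose P i (n : nat) := forall y, `|y - x0| <= n.+1%:R^-1 ->
  `|'D_(ebasis R i) g y - 'D_(ebasis R i) g x0| <= e.
have [n Pn] : exists n, forall i, P i n.
  apply: fin_unif_nat => [i k l kl Pk y yl|i].
    by apply: Pk; apply: le_trans yl _; exact: natSinv_le.
  have /cvgrPdist_le /(_ e e0) /nbhs_ballP[del /= del0 H] := cg i.
  have [m mdel] := natSinv_lt del0.
  exists m => y ym; rewrite distrC; apply: H.
  by rewrite -ball_normE /ball_ /= distrC; exact: le_lt_trans mdel.
exists n.+1%:R^-1 => [|x i s bx bsx]; first by rewrite invr_gt0.
rewrite row_jacobianT; apply: rV_norm_le => [|j]; first by rewrite mulr_ge0// ltW.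
set c := ('D_(ebasis R i) g x0) 0 j.
have D t : is_derive t (1 : R) (fun s => g (upd x i s) 0 j - s * c)
    (('D_(ebasis R i) g (upd x i t)) 0 j - c).
  by apply: is_derive_sub_linear; exact: is_derive_coord_line.
have := norm_le_MVT (a := x 0 i) (b := x 0 i + s) (e := e) D.
rewrite upd_id upd_shift (addrC (x 0 i)) addrK => H.
rewrite !mxE; have -> : g (s *: ebasis R i + x) 0 j - g x 0 j - s * c =
  g (s *: ebasis R i + x) 0 j - (s + x 0 i) * c - (g x 0 j - x 0 i * c) by ring.
apply: H => t /andP[t1 t2].
have := rV_coord_le ('D_(ebasis R i) g (upd x i t) - 'D_(ebasis R i) g x0) j.
rewrite !mxE => Hj; apply: (le_trans Hj); apply: Pn.
apply: box_norm => [|k]; first by rewrite invr_ge0.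
rewrite updE; case: eqP => [->|_]; last exact: bx.
have := bx i; have := bsx i; rewrite !mxE !eqxx mulr1.
move: t1 t2; rewrite ge_min le_max !ltr_norml.
move: n.+1%:R^-1 => u.
by move=> /orP[] ? /orP[] ? /andP[? ?] /andP[? ?]; apply/andP; split; lra.
Qed.

End SeveralVariables.

(** * A C^1 plane curve contains no surface patch *)

Section NoSurface.
Context {R : realType}.

Definition C1 (f : R -> R) :=
  (forall t, derivable f t 1) /\ continuous (derive1 f).

Lemma C1_continuous f : C1 f -> continuous f.
Proof.
move=> [df _] t; apply: differentiable_continuous.
exact/derivable1_diffP/df.
Qed.

Lemma continuous_pair (f g : R -> R) : continuous f -> continuous g ->
  continuous (fun t => (f t, g t)).
Proof.
move=> cf cg t.
exact: (@cvg_pair _ _ _ (nbhs t) (nbhs (f t)) (nbhs (g t)) _ _ _ f g (cf t) (cg t)).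
Qed.

Lemma nat_dist_ge1 (m n : nat) : m != n -> 1 <= `|m%:R - n%:R| :> R.
Proof.
rewrite neq_ltn => /orP[] mn; [rewrite distrC|].
  by rewrite ger0_norm ?subr_ge0 ?ler_nat ?(ltnW mn)// lerBrDl natr1 ler_nat.
by rewrite ger0_norm ?subr_ge0 ?ler_nat ?(ltnW mn)// lerBrDl natr1 ler_nat.
Qed.

(** The planar map has the identity as derivative at [(a, b)]. Near that point each of the four
    increments errs by at most a quarter of [|s' - s|] or [|t' - t|], in total half of their sum,
    whence the factor 2. *)
Lemma C1_graph_sum_expands (p1 p2 q1 q2 : R -> R) (a b : R) :
  C1 p1 -> C1 p2 -> C1 q1 -> C1 q2 ->
  derive1 p1 a = 1 -> derive1 p2 b = 0 ->
  derive1 q1 a = 0 -> derive1 q2 b = 1 ->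
  exists2 del, 0 < del & forall s s' t t',
    `|s - a| < del -> `|s' - a| < del -> `|t - b| < del -> `|t' - b| < del ->
    `|s' - s| + `|t' - t| <= 2 * (`|p1 s' + p2 t' - (p1 s + p2 t)| +
      `|q1 s' + q2 t' - (q1 s + q2 t)|).
Proof.
move=> [dp1 cp1] [dp2 cp2] [dq1 cq1] [dq2 cq2] p1a p2b q1a q2b.
have e0 : 0 < 4^-1 :> R by rewrite invr_gt0.
have [d1 d10 H1] := C1_strict dp1 (cp1 a) e0.
have [d2 d20 H2] := C1_strict dp2 (cp2 b) e0.
have [d3 d30 H3] := C1_strict dq1 (cq1 a) e0.
have [d4 d40 H4] := C1_strict dq2 (cq2 b) e0.
exists (Num.min (Num.min d1 d2) (Num.min d3 d4)); first by rewrite !lt_min d10 d20 d30.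
move=> s s' t t'; rewrite !lt_min.
move=> /andP[/andP[s1 _] /andP[s3 _]] /andP[/andP[s1' _] /andP[s3' _]].
move=> /andP[/andP[_ t2] /andP[_ t4]] /andP[/andP[_ t2'] /andP[_ t4']].
have := H1 s s' s1 s1'; have := H2 t t' t2 t2'.
have := H3 s s' s3 s3'; have := H4 t t' t4 t4'.
rewrite p1a p2b q1a q2b !mulr1 !mulr0 !subr0 => B4 B3 B2 B1.
have : `|s' - s| <= `|p1 s' + p2 t' - (p1 s + p2 t)| +
    (`|p1 s' - p1 s - (s' - s)| + `|p2 t' - p2 t|).
  rewrite [X in `|X| <= _](_ : _ = (p1 s' + p2 t' - (p1 s + p2 t)) -
    ((p1 s' - p1 s - (s' - s)) + (p2 t' - p2 t))); last by ring.
  by rewrite (le_trans (ler_normB _ _))// lerD2l ler_normD.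
have : `|t' - t| <= `|q1 s' + q2 t' - (q1 s + q2 t)| +
    (`|q1 s' - q1 s| + `|q2 t' - q2 t - (t' - t)|).
  rewrite [X in `|X| <= _](_ : _ = (q1 s' + q2 t' - (q1 s + q2 t)) -
    ((q1 s' - q1 s) + (q2 t' - q2 t - (t' - t)))); last by ring.
  by rewrite (le_trans (ler_normB _ _))// lerD2l ler_normD.
lra.
Qed.

(* By Baire a compact arc of the curve would contain the image of a box; the
   arc is Lipschitz, whereas the box contains large separated grids. *)
Lemma C1_curve_no_surface (p1 p2 q1 q2 g1 g2 : R -> R) (a b : R) :
  C1 p1 -> C1 p2 -> C1 q1 -> C1 q2 -> C1 g1 -> C1 g2 ->
  derive1 p1 a = 1 -> derive1 p2 b = 0 ->
  derive1 q1 a = 0 -> derive1 q2 b = 1 ->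
  ~ (forall s t, exists u, g1 u = p1 s + p2 t /\ g2 u = q1 s + q2 t).
Proof.
move=> Cp1 Cp2 Cq1 Cq2 Cg1 Cg2 p1a p2b q1a q2b cov.
have [del del0 expand] := C1_graph_sum_expands Cp1 Cp2 Cq1 Cq2 p1a p2b q1a q2b.
pose x0 : 'rV[R]_2 := \row_k (if k == 0 then a else b).
pose G (x : 'rV[R]_2) := (p1 (x 0 0) + p2 (x 0 1), q1 (x 0 0) + q2 (x 0 1)).
(* These are the points sent into the arc with parameters in [[-n, n]]; the arc is compact, so its
   preimage on each axis line is closed. *)
pose F (n : nat) : set 'rV[R]_2 :=
  [set x | ((fun u => (g1 u, g2 u)) @` [set` `[- n%:R, n%:R]%R]) (G x)].
have [|||x|n [x [r [Wx r0 H]]]] := @sep_baire_meet R 2 F (box x0 del).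
- exact: sep_open_box.
- by exists x0; exact: box_center.
- move=> n x i.
  have cG : continuous (fun t => G (upd x i t)).
    have cu j : continuous (fun t => upd x i t 0 j).
      rewrite (_ : (fun t => _) = fun t => if j == i then t else x 0 j).
        by case: (j == i) => t; [exact: cvg_id | exact: cst_continuous].
      by apply/funext => t; rewrite updE.
    have cc f j : C1 f -> continuous (fun t => f (upd x i t 0 j)).
      move=> /C1_continuous cf t.
      by apply: (@continuous_comp _ _ _ (fun t => upd x i t 0 j) f);
        [exact: cu|exact: cf].
    by apply: continuous_pair => t; apply: continuousD; exact: cc.
  apply: (@preimage_closed _ _ (fun t => G (upd x i t))
     ((fun u => (g1 u, g2 u)) @` [set` `[- n%:R, n%:R]%R])).
    by move=> t _; exact: cG.
  apply: compact_closed; first exact: norm_hausdorff.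
  apply: continuous_compact; last exact: segment_compact.
  apply: continuous_subspaceT.
  by apply: continuous_pair; exact: C1_continuous.
- have [u [u1 u2]] := cov (x 0 0) (x 0 1).
  exists (Num.bound `|u|), u; last by rewrite u1 u2.
  by rewrite /= in_itv /= -ler_norml; apply/ltW/archi_boundP.
have [r1 r10 sub1] := box_inner Wx.
pose rho := Num.min r r1.
have rho0 : 0 < rho by rewrite lt_min r0.
have [L1 L10 lip1] := C1_lipschitz n%:R Cg1.1 Cg1.2.
have [L2 L20 lip2] := C1_lipschitz n%:R Cg2.1 Cg2.2.
pose L := 2 * (L1 + L2).
have L0 : 0 < L by rewrite /L; lra.
(* An [m] by [m] grid of mesh [rho / m] is mapped into the arc. Expansion by [G] and the Lipschitz
   bounds on the curve force the parameters to be [rho / L / m] apart. *)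
apply: (@separated_grid_absurd R n%:R (rho / L)); first exact: divr_gt0.
move=> m m0; have mR : 0 < m%:R :> R by rewrite ltr0n.
pose pt (z : 'I_m * 'I_m) : 'rV[R]_2 :=
  \row_k (x 0 k + rho * ((if k == 0 then z.1 else z.2)%:R / m%:R)).
have ptx z : box x rho (pt z).
  move=> k; rewrite mxE [X in `|X|]addrAC subrr add0r.
  rewrite ger0_norm; last by rewrite mulr_ge0// ?divr_ge0// ltW.
  rewrite -[ltRHS]mulr1 ltr_pM2l// ltr_pdivrMr// mul1r ltr_nat.
  by case: ifP.
have ptd z k : `|pt z 0 k - x0 0 k| < del.
  by apply: sub1; apply: box_le (ptx z); rewrite ge_min lexx orbT.
have /choice[u Hu] : forall z, exists u, `|u| <= n%:R /\ (g1 u, g2 u) = G (pt z).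
  move=> z; have [|u uN uE] := H (pt z).
    by apply: box_le (ptx z); rewrite ge_min lexx.
  by exists u; move: uN; rewrite /= in_itv /= -ler_norml.
exists u; split => [z|z z' zz']; first by have [] := Hu z.
have [uz [e1 e2]] := Hu z; have [uz' [e1' e2']] := Hu z'.
have := expand (pt z' 0 0) (pt z 0 0) (pt z' 0 1) (pt z 0 1).
have := ptd z 0; have := ptd z' 0; have := ptd z 1; have := ptd z' 1.
rewrite [x0 0 0]mxE [x0 0 1]mxE /= => b1 b2 b3 b4 /(_ b3 b4 b1 b2).
rewrite -e1 -e2 -e1' -e2'.
have := lip1 _ _ uz' uz; have := lip2 _ _ uz' uz => l2 l1 B.
have {l1 l2}B : `|pt z 0 0 - pt z' 0 0| + `|pt z 0 1 - pt z' 0 1| <=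
    L * `|u z - u z'|.
  by rewrite /L; lra.
rewrite mulrAC ler_pdivrMr// [leRHS]mulrC; apply: le_trans B.
have E k : pt z 0 k - pt z' 0 k = rho / m%:R *
    ((if k == 0 then z.1 else z.2)%:R - (if k == 0 then z'.1 else z'.2)%:R).
  by rewrite !mxE; ring.
have rm0 : 0 < rho / m%:R by rewrite divr_gt0.
rewrite !E /= !(normrM (rho / m%:R)) (gtr0_norm rm0) -mulrDr.
rewrite -[leLHS]mulr1 ler_wpM2l ?(ltW rm0)//.
case: z z' zz' {e1 e2 e1' e2' uz uz' b1 b2 b3 b4 E} => [z1 z2] [z1' z2'] /=.
rewrite xpair_eqE negb_and => /orP[] zz.
  by rewrite -[leLHS]addr0 lerD//; exact: nat_dist_ge1.
by rewrite -[leLHS]add0r lerD//; exact: nat_dist_ge1.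
Qed.

End NoSurface.

(** * Curves that are sums of curves *)

Section VectorCurves.
Context {R : realType}.

Lemma is_derive_mulmx n (f : R -> 'rV[R]_n) (B : 'cV[R]_n) c t :
  derivable f t 1 ->
  is_derive t (1 : R) (fun t => (f t *m B) 0 0 + c) ((derive1 f t *m B) 0 0).
Proof.
move=> df.
have D (i : 'I_n) : is_derive t (1 : R) (B i 0 \*: (fun s => f s 0 i))
    (B i 0 *: (derive1 f t) 0 i).
  apply: is_deriveZ; rewrite derive1E derive_mx// mxE.
  by apply/derivableP; move/derivable_mxP : df; exact.
have := is_derive_sum D => Ds.
have := is_deriveD Ds (is_derive_cst c t 1).
rewrite addr0 => H.
rewrite (_ : (fun t => _) =
   (\sum_(i < n) (B i 0 \*: (fun s => f s 0 i))) + cst c).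
  rewrite mxE (eq_bigr (fun i => B i 0 *: (derive1 f t) 0 i))// => i _.
  by rewrite mulrC.
apply/funext => s; rewrite /= mxE /GRing.add /= fct_sumE; congr (_ + _).
by apply: eq_bigr => i _; rewrite mulrC.
Qed.

Lemma C1_mulmx n (f : R -> 'rV[R]_n) (B : 'cV[R]_n) c :
  (forall t, derivable f t 1) -> (forall t, derivable (derive1 f) t 1) ->
  C1 (fun t => (f t *m B) 0 0 + c) /\
  forall t, derive1 (fun t => (f t *m B) 0 0 + c) t = (derive1 f t *m B) 0 0.
Proof.
move=> df ddf.
have E t : derive1 (fun t => (f t *m B) 0 0 + c) t = (derive1 f t *m B) 0 0.
  have H := is_derive_mulmx B c (df t).
  by rewrite derive1E; exact: derive_val.
split=> //; split => t.
  by have H := is_derive_mulmx B c (df t); exact: ex_derive.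
rewrite (_ : derive1 _ = fun t => (derive1 f t *m B) 0 0 + 0); last first.
  by apply/funext => s; rewrite E addr0.
apply: differentiable_continuous; apply/derivable1_diffP.
by have H := is_derive_mulmx B 0 (ddf t); exact: ex_derive.
Qed.

Lemma col_mulmx m n p (A : 'M[R]_(m, n)) (B : 'M[R]_(n, p)) j :
  col j (A *m B) = A *m col j B.
Proof. by rewrite !colE mulmxA. Qed.

Definition affinely_spanning n (f : R -> 'rV[R]_n) :=
  forall eta : 'cV[R]_n, (forall u v, f u *m eta = f v *m eta) -> eta = 0.

(** Strong exponentiality is applied to the whole line, which has infinite measure. *)
Lemma strongly_exponential_affinely_spanning d (k : 'I_d -> nat)
  (T : forall i, R -> 'rV[R]_(k i)) :
  strongly_exponential T -> forall i, affinely_spanning (T i).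
Proof.
move=> seT i eta H.
have [|||/eqP] := seT i setT eta^T.
- exact: measurableT.
- exists ((T i 0 *m eta) 0 0) => u _.
  by rewrite /inner trmxK (H u 0).
- have := @lebesgue_measure_itv R `]-oo, +oo[%R.
  rewrite set_itvE /= => -> //.
- by rewrite trmx_eq0 => /eqP.
Qed.

Lemma constant_mulmx n m (f : R -> 'rV[R]_n) (B : 'M[R]_(n, m)) :
  (forall t, derivable f t 1) -> (forall t, derive1 f t *m B = 0) ->
  forall u v, f u *m B = f v *m B.
Proof.
move=> df H u v; apply/rowP => j.
have D t : is_derive t (1 : R) (fun t => (f t *m col j B) 0 0 + 0) 0.
  have := is_derive_mulmx (col j B) 0 (df t).
  by rewrite -col_mulmx H col0 [(0 : 'cV_1) 0 0]mxE.
have := is_derive_0_is_cst u v D.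
by rewrite !addr0 -!col_mulmx !mxE.
Qed.

(** The columns of [cokermx u] vanish on [u], and some column does not vanish on [w]; it is
    rescaled. *)
Lemma separating_functional m (u w : 'rV[R]_m) : ~~ (w <= u)%MS ->
  exists2 psi : 'cV[R]_m, u *m psi = 0 & (w *m psi) 0 0 = 1.
Proof.
rewrite submxE => /eqP/rowP nz.
have [l wl] : exists l, (w *m cokermx u) 0 l != 0.
  apply: contrapT => H; apply: nz => l; rewrite [RHS]mxE.
  by apply/eqP/negPn/negP => wl; apply: H; exists l.
exists (((w *m cokermx u) 0 l)^-1 *: col l (cokermx u)).
  by rewrite -scalemxAr -col_mulmx mulmx_coker col0 scaler0.
by rewrite -scalemxAr -col_mulmx !mxE mulVf//; move: wl; rewrite mxE.
Qed.

Variables (d m : nat) (k : 'I_d -> nat) (T : forall j, R -> 'rV[R]_(k j)).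
Variables (gam : R -> 'rV[R]_m) (M : forall j, 'M[R]_(k j, m)) (c : 'rV[R]_m).
Hypotheses (dT : forall j t, derivable (T j) t 1)
  (ddT : forall j t, derivable (derive1 (T j)) t 1)
  (ndT : forall j, affinely_spanning (T j)).
Hypotheses (dgam : forall t, derivable gam t 1)
  (ddgam : forall t, derivable (derive1 gam) t 1)
  (ndgam : affinely_spanning gam) (m2 : (2 <= m)%N).
Hypothesis sum_gam : forall z : 'rV[R]_d,
  exists u, gam u = \sum_j T j (z 0 j) *m M j + c.
Hypothesis gam_sum : forall u,
  exists z : 'rV[R]_d, gam u = \sum_j T j (z 0 j) *m M j + c.

Let D j t := derive1 (T j) t *m M j.

Lemma nonzero_block_derivative j : M j != 0 -> exists a, D j a != 0.
Proof.
move=> Mj; apply: contrapT => H; move/eqP: Mj; apply.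
have D0 t : D j t = 0.
  by apply/eqP/negPn/negP => Dt; apply: H; exists t.
have cst := constant_mulmx (@dT j) D0.
apply/matrixP => i l; rewrite [RHS]mxE.
have /matrixP/(_ i 0) : col l (M j) = 0.
  by apply: ndT => u v; rewrite -!col_mulmx (cst u v).
by rewrite !mxE.
Qed.

(** Independent derivatives would admit dual functionals [phi] and [psi]. Projected by them, varying
    the coordinates [j1] and [j2] sweeps a planar map with identity derivative at [(a, b)], inside
    the projected C^1 curve [gam]. *)
Lemma derivatives_dependent j1 j2 a b :
  j1 != j2 -> D j1 a != 0 -> (D j2 b <= D j1 a)%MS.
Proof.
move=> j12 Da; apply/negPn/negP => nsub.
have nsub' : ~~ (D j1 a <= D j2 b)%MS.
  apply/negP => /sub_rVP[x E]; move/negP: nsub; apply; apply/sub_rVP.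
  have x0 : x != 0 by apply/eqP => x0; move: Da; rewrite E x0 scale0r eqxx.
  by exists x^-1; rewrite E scalerA mulVf// scale1r.
have [psi psi0 psi1] := separating_functional nsub.
have [phi phi0 phi1] := separating_functional nsub'.
(* The contribution of all other coordinates, frozen at 0. *)
pose kap : 'rV[R]_m :=
  \sum_(j < d | (j != j1) && (j != j2)) T j 0 *m M j + c.
have C1T j (B : 'cV[R]_m) x := C1_mulmx (M j *m B) x (@dT j) (@ddT j).
have C1g (B : 'cV[R]_m) := C1_mulmx B 0 dgam ddgam.
apply: (@C1_curve_no_surface R _ _ _ _ _ _ a b
  (C1T j1 phi 0).1 (C1T j2 phi ((kap *m phi) 0 0)).1
  (C1T j1 psi 0).1 (C1T j2 psi ((kap *m psi) 0 0)).1 (C1g phi).1 (C1g psi).1).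
- by rewrite (C1T j1 phi 0).2 mulmxA.
- by rewrite (C1T j2 phi _).2 mulmxA phi0 mxE.
- by rewrite (C1T j1 psi 0).2 mulmxA psi0 mxE.
- by rewrite (C1T j2 psi _).2 mulmxA.
move=> s t.
pose z : 'rV[R]_d := \row_j (if j == j1 then s else if j == j2 then t else 0).
have [u gu] := sum_gam z; exists u.
have {}gu : gam u = T j1 s *m M j1 + (T j2 t *m M j2 + kap).
  rewrite gu (bigD1 j1)//= (bigD1 j2) 1?eq_sym//= -!addrA; congr (_ + (_ + _)).
  - by rewrite mxE eqxx.
  - by rewrite mxE eqxx eq_sym (negPf j12).
  - congr (_ + _); apply: eq_bigr => j /andP[/negPf jj1 /negPf jj2].
    by rewrite mxE jj1 jj2.
by rewrite gu !mulmxDl ![in LHS]mxE !mulmxA !addr0 !mxE.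
Qed.

(** With two nonzero blocks all derivatives [D j t] lie on one line. As [m] is at least 2, a nonzero
    functional kills that line, hence is constant on [gam], against affine spanning. *)
Lemma at_most_one_block_of_curve j1 j2 : M j1 != 0 -> M j2 != 0 -> j1 = j2.
Proof.
move=> /nonzero_block_derivative[a Da] /nonzero_block_derivative[b Db].
apply/eqP/negPn/negP => j12.
(* Dependence compares distinct coordinates only, so [j = j1] is reached through [j2]. *)
have sub j t : (D j t <= D j1 a)%MS.
  have [->|jj1] := eqVneq j j1; last by apply: derivatives_dependent; rewrite // eq_sym.
  apply: (submx_trans (B := D j2 b)); last exact: derivatives_dependent.
  by apply: derivatives_dependent; rewrite // eq_sym.
have : cokermx (D j1 a) != 0.
  rewrite -mxrank_eq0 mxrank_coker subn_eq0 -ltnNge.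
  by apply: leq_ltn_trans m2; exact: rank_leq_row.
apply/negP; rewrite negbK; apply/eqP/matrixP => i l; rewrite [RHS]mxE.
have /matrixP/(_ i 0) : col l (cokermx (D j1 a)) = 0.
  apply: ndgam => u v.
  have [z ->] := gam_sum u; have [z' ->] := gam_sum v.
  rewrite !mulmxDl !mulmx_suml; congr (_ + _); apply: eq_bigr => j _.
  rewrite -!mulmxA; apply: constant_mulmx => // t.
  have /submxP[x Dx] := sub j t.
  by rewrite mulmxA -/(D j t) Dx -mulmxA -col_mulmx mulmx_coker col0 mulmx0.
by rewrite !mxE.
Qed.

End VectorCurves.

(** * Non-monotonic statistics *)

Section LocalExtrema.
Context {R : realType}.
Implicit Types (f : R -> R).

Definition local_extremum f u := exists2 del, 0 < del &
  (forall t, `|t - u| < del -> f t <= f u) \/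
  (forall t, `|t - u| < del -> f u <= f t).

Lemma local_extremum_derive f u :
  (forall t, derivable f t 1) -> local_extremum f u -> derive1 f u = 0.
Proof.
move=> df [del del0 ext].
have ab : u - del <= u + del by lra.
have uin : u \in `](u - del), (u + del)[%R by rewrite in_itv /=; apply/andP; split; lra.
have near t : t \in `](u - del), (u + del)[%R -> `|t - u| < del.
  by rewrite in_itv /= ltr_norml => /andP[? ?]; apply/andP; split; lra.
rewrite derive1E; case: ext => ext.
  have H := derive1_at_max ab (fun t _ => df t) uin
    (fun t tin => ext t (near t tin)).
  exact: derive_val.
have H := derive1_at_min ab (fun t _ => df t) uin
  (fun t tin => ext t (near t tin)).
exact: derive_val.
Qed.

Lemma interior_local_extremum f p q u : p < u < q ->
  (forall t, t \in `[p, q]%R -> f t <= f u) \/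
  (forall t, t \in `[p, q]%R -> f u <= f t) -> local_extremum f u.
Proof.
move=> /andP[pu uq] ext.
exists (Num.min (u - p) (q - u)); first by rewrite lt_min !subr_gt0 pu.
have near t : `|t - u| < Num.min (u - p) (q - u) -> t \in `[p, q]%R.
  rewrite lt_min !ltr_norml in_itv /= => /andP[/andP[? ?] /andP[? ?]].
  by apply/andP; split; lra.
by case: ext => ext; [left|right] => t /near; exact: ext.
Qed.

(** Without local extrema [f] is injective: equal values at [p] and [q] force an interior maximum or
    minimum on [[p, q]], or else [f] is constant there. A continuous injective function is
    monotone. *)
Lemma nonmonotone_local_extremum f : continuous f -> ~ Defs.monotone f ->
  exists u, local_extremum f u.
Proof.
move=> cf nmono; apply: contrapT => noext.
have neq p q : p < q -> f p <> f q.
  move=> pq fpq; apply: noext.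
  have cw : {within `[p, q], continuous f} by exact: continuous_subspaceT.
  have [cM + HM] := EVT_max (ltW pq) cw.
  have [cm + Hm] := EVT_min (ltW pq) cw.
  rewrite !in_itv /= => /andP[m1 m2] /andP[M1 M2].
  have [Mint|Mend] := boolP (p < cM < q).
    by exists cM; apply: interior_local_extremum Mint _; left.
  have [mint|mend] := boolP (p < cm < q).
    by exists cm; apply: interior_local_extremum mint _; right.
  have ends c : p <= c -> c <= q -> ~~ (p < c < q) -> f c = f p.
    rewrite !le_eqVlt => /orP[/eqP <-//|pc] /orP[/eqP ->//|cq].
    by rewrite pc cq.
  have midin : p < (p + q) / 2 < q by apply/andP; split; lra.
  exists ((p + q) / 2); apply: (interior_local_extremum midin); left => t tpq.
  rewrite (le_trans (HM _ tpq))// (ends cM)// -(ends cm)//; apply: Hm.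
  by move: midin; rewrite in_itv /= => /andP[/ltW -> /ltW ->].
have inj : {in `]-oo, +oo[ &, injective f}.
  move=> p q _ _ fpq; apply/eqP; rewrite eq_le !leNgt.
  by apply/andP; split; apply/negP => /neq; apply.
have cw : {within [set` `]-oo, +oo[], continuous f}.
  exact: continuous_subspaceT.
have inT (t : R) : t \in `]-oo, +oo[ by rewrite in_itv.
apply: nmono; case: (itv_continuous_inj_mono cw inj) => mono; [left|right] => a b;
  by rewrite le_eqVlt => /orP[/eqP->//|ab]; apply/ltW/mono.
Qed.

Definition nonconstant_on_intervals f :=
  forall p q, p < q -> exists2 t, p <= t <= q & f t <> f p.

(** If [phi] took two values, every value between them would be critical by the intermediate value
    theorem, and [f] would be constant on that interval. *)
Lemma path_in_critical_set_constant f (phi : R -> R) :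
  (forall t, derivable f t 1) -> nonconstant_on_intervals f ->
  continuous phi -> (forall t, derive1 f (phi t) = 0) ->
  forall s t, phi s = phi t.
Proof.
move=> df ncst cphi crit.
suff H s t : ~ phi s < phi t.
  move=> s t; apply/eqP; rewrite eq_le !leNgt; apply/andP.
  by split; apply/negP; exact: H.
move=> /[dup] st /ncst[u /andP[su ut]]; apply.
have cstd v : phi s <= v <= phi t -> derive1 f v = 0.
  move=> /andP[sv vt].
  have [ts|ts] := leP s t.
    have [|c _ <- //] := @IVT _ phi s t v ts (continuous_subspaceT cphi).
    by rewrite ge_min le_max sv vt orbT.
  have [|c _ <- //] := @IVT _ phi t s v (ltW ts) (continuous_subspaceT cphi).
  by rewrite ge_min le_max sv vt !orbT.
have := @norm_le_MVT R f (derive1 f) (phi s) u 0.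
rewrite mul0r normr_le0 subr_eq0 => H; apply/eqP; apply: H => v.
  by rewrite derive1E; exact/derivableP/df.
rewrite min_l// max_r// => /andP[sv vu]; rewrite cstd ?normr0//.
by rewrite sv (le_trans vu).
Qed.

End LocalExtrema.

(** * C^1 maps and level hypersurfaces of a non-monotonic statistic *)

Section C1Maps.
Context {R : realType} {d : nat}.
Implicit Types (g h : 'rV[R]_d -> 'rV[R]_d) (x y : 'rV[R]_d) (i j l : 'I_d).

Definition C1map g :=
  partially_derivable g /\ forall i, continuous ('D_(ebasis R i) g).

Lemma C1_diffeo_C1map g ginv : C1_diffeo g ginv ->
  [/\ cancel g ginv, cancel ginv g, C1map g & C1map ginv].
Proof.
move=> [gK [ginvK H]]; split=> //.
  by have [dg cg] := H g (or_introl erefl).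
by have [dg cg] := H ginv (or_intror erefl).
Qed.

Lemma C1map_near_lin g x e : C1map g -> 0 < e ->
  exists2 r, 0 < r & near_lin g x r (jacobian g x)^T e.
Proof. by move=> [dg cg]; apply: near_lin_C1 => // i; exact: cg. Qed.

Lemma C1map_lipschitz g x : C1map g ->
  exists r N, [/\ 0 < r, 0 <= N & near_lin g x r 0 N].
Proof.
move=> Cg; have [r r0 gA] := C1map_near_lin x Cg (@ltr01 R).
have [K K0 HK] := rV_mulmx_le (jacobian g x)^T.
exists r, (1 + K); split=> // [|y i s by_ bsy]; first lra.
rewrite row0 scaler0 subr0 mulrDl.
rewrite -[X in `|X|](subrK (s *: row i (jacobian g x)^T)).
apply: (le_trans (ler_normD _ _)); apply: lerD; first exact: gA.
rewrite rowE normrZ mulrC ler_wpM2r// (le_trans (HK _))//.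
rewrite -[leRHS]mulr1 ler_wpM2l ?(ltW K0)//; apply: rV_norm_le => // k.
by rewrite mxE; case: (_ && _); rewrite ?normr1 ?normr0.
Qed.

Lemma C1map_continuous g : C1map g -> continuous g.
Proof.
move=> Cg x; have [r [N [r0 N0 gN]]] := C1map_lipschitz x Cg.
exact: near_lin_continuous r0 N0 gN.
Qed.

(** Near-linearity of [h] now holds around every point, so the determinant vanishes nowhere, instead
    of being nonzero on a dense set only. *)
Lemma C1map_jacobian g h x : cancel g h -> C1map g -> C1map h ->
  \det (jacobian g x) != 0.
Proof.
move=> gK Cg Ch; have [r [N [r0 N0 gN]]] := C1map_lipschitz x Cg.
pose D : R := (4 * (d%:R + 1))^-1.
have D0 : 0 < D by rewrite /D invr_gt0; have := ler0n R d; lra.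
pose e := D / (d%:R * N + 1).
have dN0 : 0 <= d%:R * N by rewrite mulr_ge0.
have e0 : 0 < e by rewrite divr_gt0//; lra.
have [r2 r20 hB] := C1map_near_lin (g x) Ch e0.
apply: (jacobian_nonsingular gK _ r0 r20 N0 (ltW e0) gN hB).
  by move=> i; exact: Cg.1.
rewrite -/D -mulrA mulrAC ler_pdivrMr; last lra.
by apply: ler_wpM2l; lra.
Qed.

(** The chain rule is obtained from estimates: the entry is at most [eta * C] for every small [eta].
    In [C], the first summand is the error of linearising [k], and [K] carries the error of
    linearising [g] through [A]. *)
Lemma chain_rule_vanishing g k p l j : C1map g -> C1map k ->
  (forall s, k (g (s *: ebasis R l + p)) 0 j = k (g p) 0 j) ->
  ('D_(ebasis R l) g p *m (jacobian k (g p))^T) 0 j = 0.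
Proof.
move=> [dg _] Ck cst.
set D := 'D__ g p; set A := (jacobian k (g p))^T.
have [K K0 HK] := rV_mulmx_le A.
pose C := d%:R * (`|D| + 1) + K.
have C0 : 0 < C.
  rewrite /C mulrDr mulr1; have := mulr_ge0 (ler0n R d) (normr_ge0 D).
  by have := ler0n R d; lra.
have H eta : 0 < eta -> eta <= 1 -> `|(D *m A) 0 j| <= eta * C.
  move=> eta0 eta1.
  have [r r0 kA] := C1map_near_lin (g p) Ck eta0.
  have [del del0 gD] := derivable_approx (dg p l) eta0.
  have DD0 : 0 < `|D| + 1 by have := normr_ge0 D; lra.
  pose s := Num.min del (r / (`|D| + 1) / 2).
  have s0 : 0 < s by rewrite lt_min del0 !divr_gt0.
  have s1 : s <= del by rewrite ge_min lexx.
  have s2 : s * (`|D| + 1) < r.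
    rewrite -ltr_pdivlMr//; apply: (@le_lt_trans _ _ (r / (`|D| + 1) / 2)).
      by rewrite ge_min lexx orbT.
    by have := divr_gt0 r0 DD0; lra.
  have := gD s; rewrite (gtr0_norm s0) -/D => /(_ s1) {}gD.
  set y := g (s *: ebasis R l + p) in gD.
  have yx : `|y - g p| <= s * (`|D| + 1).
    rewrite -[X in `|X|](subrK (s *: D)) (le_trans (ler_normD _ _))//.
    rewrite normrZ (gtr0_norm s0) mulrDr mulr1 addrC lerD2l.
    by apply: (le_trans gD); rewrite -[leRHS]mul1r ler_wpM2r// ltW.
  have bxy : box (g p) r y by apply: norm_box; exact: le_lt_trans s2.
  have := near_lin_norm (ltW eta0) kA (box_center _ r0) bxy.
  move=> /(le_trans (rV_coord_le _ j)).
  rewrite mxE [X in X + _]mxE [(- k _) 0 j]mxE cst subrr add0r mxE normrN => H1.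
  have H2 := le_trans (rV_coord_le _ j) (le_trans (HK _) (ler_wpM2l (ltW K0) gD)).
  rewrite -(ler_pM2l s0) -{1}(gtr0_norm s0) -normrM.
  have ent (a b u : 'rV[R]_d) : a = b + s *: u -> s * u 0 j = a 0 j - b 0 j.
    by move=> ->; rewrite !mxE; ring.
  have E : (y - g p) *m A = (y - g p - s *: D) *m A + s *: (D *m A).
    by rewrite (mulmxBl (y - g p)) -scalemxAl subrK.
  rewrite (ent _ _ _ E).
  apply: (le_trans (ler_normB _ _)).
  have ed0 : 0 <= eta * d%:R by rewrite mulr_ge0// ltW.
  have := ler_wpM2l ed0 yx; rewrite /C; lra.
apply/eqP; rewrite -normr_eq0 eq_le normr_ge0 andbT leNgt; apply/negP => pos.
set q := `|_| in pos H.
have q0 : 0 < q / (2 * C) by rewrite divr_gt0//; lra.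
have := H (Num.min 1 (q / (2 * C))).
rewrite lt_min ltr01 q0 ge_min lexx => /(_ isT isT).
have : Num.min 1 (q / (2 * C)) * C <= q / (2 * C) * C.
  by rewrite ler_wpM2r ?(ltW C0)// ge_min lexx orbT.
have -> : q / (2 * C) * C = q / 2 by field; rewrite gt_eqF.
lra.
Qed.

(** Two columns supported on the single row [i] are linearly dependent; [v] is the relation between
    them. *)
Lemma unitmx_two_columns n (P : 'M[R]_n) (i j1 j2 : 'I_n) : P \in unitmx ->
  (forall a, a != i -> P a j1 = 0 /\ P a j2 = 0) -> j1 = j2.
Proof.
move=> uP P0; apply/eqP/negPn/negP => j12.
pose v : 'cV[R]_n := P i j2 *: delta_mx j1 0 - P i j1 *: delta_mx j2 0.
have col0 (j : 'I_n) : (j = j1) \/ (j = j2) ->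
    P *m delta_mx j (0 : 'I_1) = P i j *: delta_mx i 0.
  move=> jj; rewrite -colE; apply/colP => l; rewrite !mxE.
  have [->|li] := eqVneq l i; first by rewrite mulr1.
  by rewrite mulr0; have [E1 E2] := P0 l li; case: jj => ->.
have Pv : P *m v = 0.
  rewrite mulmxBr -!scalemxAr !col0; [|by right|by left].
  by rewrite !scalerA mulrC subrr.
have inj (u : 'cV[R]_n) : P *m u = 0 -> u = 0.
  by move=> Pu; rewrite -[u]mul1mx -(mulVmx uP) -mulmxA Pu mulmx0.
have /colP/(_ j1) := inj _ Pv.
rewrite !mxE !eqxx (negPf j12) /= mulr1 mulr0 subr0 => Pij2.
have /colP/(_ j2) : delta_mx j2 (0 : 'I_1) = 0 :> 'cV[R]_n.
  by apply: inj; rewrite col0 ?Pij2 ?scale0r//; right.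
by rewrite !mxE !eqxx; apply/eqP/oner_neq0.
Qed.

(* On the hypersurface where [f \o v_i] is at an extremal value, every
   coordinate on which [f \o v_i] really depends is critical, hence constant;
   two such coordinates would have parallel gradients. *)
Lemma at_most_one_nonmonotone (h hinv ht htinv : 'rV[R]_d -> 'rV[R]_d) i
  (f : R -> R) (tau : 'I_d -> R -> R) (c : R) j1 j2 :
  C1_diffeo h hinv -> C1_diffeo ht htinv ->
  continuous f -> ~ Defs.monotone f -> (forall j t, derivable (tau j) t 1) ->
  (forall z, f (htinv (h z) 0 i) = \sum_j tau j (z 0 j) + c) ->
  nonconstant_on_intervals (tau j1) -> nonconstant_on_intervals (tau j2) ->
  j1 = j2.
Proof.
move=> /C1_diffeo_C1map[hK hinvK Ch Chinv] /C1_diffeo_C1map[htK htinvK Cht Chtinv].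
move=> cf nmono dtau fsum nc1 nc2.
have [us [del del0 ext]] := nonmonotone_local_extremum cf nmono.
have comp g g' z j b : C1map g -> C1map g' ->
    continuous (fun t => g' (g (upd z j t)) 0 b).
  move=> [dg _] /C1map_continuous cg' t.
  apply: (@continuous_comp _ _ _ (fun t => g' (g (upd z j t)))
    (fun x => x 0 b)); last exact: coord_continuous.
  apply: (@continuous_comp _ _ _ (fun t => g (upd z j t)) g'); last exact: cg'.
  exact: partially_derivable_sep.
(* With the other coordinates frozen, [tau j] is up to the constant [C] the function [f] along a
   continuous path through [us], and inherits its local extremum. *)
have crit z j : htinv (h z) 0 i = us -> derive1 (tau j) (z 0 j) = 0.
  move=> zus; apply: local_extremum_derive; first exact: dtau.
  pose C := \sum_(j' | j' != j) tau j' (z 0 j') + c.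
  have E t : f (htinv (h (upd z j t)) 0 i) = tau j t + C.
    rewrite fsum (bigD1 j)//= updE eqxx -addrA; congr (_ + (_ + _)).
    by apply: eq_bigr => j' /negPf jj'; rewrite updE jj'.
  have /cvgrPdist_lt /(_ del del0) := comp h htinv z j i Ch Chtinv (z 0 j).
  rewrite upd_id zus => /nbhs_ballP[e /= e0 H]; exists e => //.
  by case: ext => ext; [left|right] => t tz;
    rewrite -(lerD2r C) -!E upd_id zus; apply: ext; rewrite distrC; apply: H;
    rewrite /ball /= distrC.
pose p : 'rV[R]_d := upd 0 i us.
have pi : p 0 i = us by rewrite updE eqxx.
(* Moving a coordinate [l] other than [i] stays in the level hypersurface, where coordinate [j] of
   [hinv \o ht] is critical for [tau j], hence constant. *)
have van l j : l != i -> nonconstant_on_intervals (tau j) ->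
    ('D_(ebasis R l) ht p *m (jacobian hinv (ht p))^T) 0 j = 0.
  move=> li ncj; apply: chain_rule_vanishing => // s.
  have cst := @path_in_critical_set_constant _ (tau j)
    (fun t => hinv (ht (upd p l t)) 0 j) (@dtau j) ncj (comp _ _ p l j Cht Chinv).
  rewrite -upd_shift (cst _ _ (p 0 l)) ?upd_id// => t.
  by apply: crit; rewrite hinvK htK updE eq_sym (negPf li).
apply: (@unitmx_two_columns _ ((jacobian ht p)^T *m (jacobian hinv (ht p))^T) i).
  rewrite unitmx_mul !unitmxE !det_tr !unitfE.
  by rewrite (C1map_jacobian _ htK)// (C1map_jacobian _ hinvK).
move=> l li.
have E j : ((jacobian ht p)^T *m (jacobian hinv (ht p))^T) l j =
    ('D_(ebasis R l) ht p *m (jacobian hinv (ht p))^T) 0 j.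
  by rewrite -row_jacobianT -row_mul [RHS]mxE.
by rewrite !E !van.
Qed.

End C1Maps.

(** * The affine relation between stacked statistics *)

Section Stacked.
Context {R : realType} {d : nat}.

Definition stackT (k : 'I_d -> nat) (T : forall i, R -> 'rV[R]_(k i))
  (z : 'rV[R]_d) : 'rV[R]_(\sum_i k i) := \mxrow_i T i (z 0 i).

Lemma stackT_mulmx (k : 'I_d -> nat) (T : forall i, R -> 'rV[R]_(k i)) n
  (P : 'M[R]_(\sum_i k i, n)) z :
  stackT T z *m P = \sum_i T i (z 0 i) *m submxcol P i.
Proof. by rewrite -{1}[P]submxcolK mul_mxrow_mxcol. Qed.

Lemma inner_stack (Y : Type) (k : 'I_d -> nat) (T : forall i, R -> 'rV[R]_(k i))
  (lam : forall i, Y -> 'rV[R]_(k i)) (z : 'rV[R]_d) y :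
  \sum_i inner (T i (z 0 i)) (lam i y) =
  (stackT T z *m (stack lam y)^T) 0 0.
Proof. by rewrite tr_mxrow mul_mxrow_mxcol summxE. Qed.

Lemma stackT_coord_continuous (k : 'I_d -> nat) (T : forall i, R -> 'rV[R]_(k i)) l :
  (forall i t, derivable (T i) t 1) ->
  continuous (fun z => stackT T z 0 l).
Proof.
move=> dT z.
have [i [a E]] : exists i a, forall z, stackT T z 0 l = T i (z 0 i) 0 a.
  by do 2 eexists; move=> w; rewrite mxE.
rewrite (_ : (fun _ => _) = fun z : 'rV[R]_d => T i (z 0 i) 0 a); last first.
  by apply/funext => w; rewrite E.
apply: (@continuous_comp _ _ _ (fun z : 'rV[R]_d => z 0 i) (fun t => T i t 0 a)).
  exact: coord_continuous.
apply: (@continuous_comp _ _ _ (T i) (fun u => u 0 a)); last exact: coord_continuous.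
by apply: differentiable_continuous; apply/derivable1_diffP.
Qed.

Lemma stackT_affine_continuous (k : 'I_d -> nat) (T : forall i, R -> 'rV[R]_(k i)) n
  (M : 'M[R]_(\sum_i k i, n)) (c : 'rV[R]_n) l :
  (forall i t, derivable (T i) t 1) ->
  continuous (fun z => (stackT T z *m M + c) 0 l).
Proof.
move=> dT z.
rewrite (_ : (fun _ => _) =
  (\sum_a (fun z => stackT T z 0 a * M a l)) + cst (c 0 l)).
  apply: continuousD; last exact: cst_continuous.
  apply: (@big_ind _ (fun f => {for z, continuous f})) => [|f g cf cg|a _].
  - exact: cst_continuous.
  - exact: continuousD.
  - apply: continuousM; last exact: cst_continuous.
    exact: stackT_coord_continuous.
by apply/funext => w; rewrite !mxE /GRing.add /= fct_sumE.
Qed.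

(** Varying only coordinate [j] shows that each column of block [j] is a functional constant on
    [T j]. *)
Lemma stackT_constant_eq0 (k : 'I_d -> nat) (T : forall i, R -> 'rV[R]_(k i)) n
  (P : 'M[R]_(\sum_i k i, n)) :
  (forall i, affinely_spanning (T i)) ->
  (forall z z', stackT T z *m P = stackT T z' *m P) -> P = 0.
Proof.
move=> ndT cst; rewrite -[P]submxcolK.
suff E j : submxcol P j = 0 by rewrite (eq_mxcol E) mxcol0.
apply/matrixP => a b; rewrite [RHS]mxE.
have /matrixP/(_ a 0) : col b (submxcol P j) = 0; last by rewrite !mxE.
apply: ndT => u v; rewrite -!col_mulmx; congr col.
pose z t : 'rV[R]_d := \row_i (if i == j then t else 0).
have E t : stackT T (z t) *m P = T j t *m submxcol P j +
    \sum_(i | i != j) T i 0 *m submxcol P i.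
  rewrite stackT_mulmx (bigD1 j)//= mxE eqxx; congr (_ + _).
  by apply: eq_bigr => i /negPf ij; rewrite mxE ij.
by have := cst (z u) (z v); rewrite !E => /addIr.
Qed.

(* At points where the Jacobian determinant is nonzero one may take logarithms;
   differences against [ys ord0] eliminate the base measure, the Jacobian and,
   up to a constant, the normalizers. *)
Lemma stackT_affine_of_densities (Y : Type) (k kt : 'I_d -> nat)
  (T : forall i, R -> 'rV[R]_(k i)) (Tt : forall i, R -> 'rV[R]_(kt i))
  (lam : forall i, Y -> 'rV[R]_(k i)) (lamt : forall i, Y -> 'rV[R]_(kt i))
  (mu mut : 'rV[R]_d -> R) (Gam Gamt : Y -> R)
  (hinv htinv : 'rV[R]_d -> 'rV[R]_d)
  (ys : 'I_(\sum_(i < d) k i).+1 -> Y) :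
  (forall z, 0 < mu z) -> (forall z, 0 < mut z) ->
  (\matrix_(l < \sum_(i < d) k i)
     (stack lam (ys (lift ord0 l)) - stack lam (ys ord0))) \in unitmx ->
  (forall y x, px T lam mu Gam hinv y x = px Tt lamt mut Gamt htinv y x) ->
  exists M c, forall x, \det (jacobian hinv x) != 0 ->
    stackT T (hinv x) = stackT Tt (htinv x) *m M + c.
Proof.
move=> mu0 mut0; set L := \matrix_l _ => uL pxE.
pose Lt := \matrix_(l < \sum_(i < d) k i)
  (stack lamt (ys (lift ord0 l)) - stack lamt (ys ord0)).
pose g : 'rV[R]_(\sum_(i < d) k i) :=
  \row_l (Gam (ys (lift ord0 l)) - Gam (ys ord0) -
    (Gamt (ys (lift ord0 l)) - Gamt (ys ord0))).
exists (Lt^T *m invmx L^T), (g *m invmx L^T) => x J0.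
have uLT : L^T \in unitmx by rewrite unitmx_tr.
have J1 : 0 < `|\det (jacobian hinv x)| by rewrite normr_gt0.
(* Equality of the densities and positivity of [mu] and [mut] transfer nonvanishing to the other
   Jacobian determinant. *)
have Jt1 : 0 < `|\det (jacobian htinv x)|.
  rewrite normr_gt0; apply/eqP => Jt0.
  have := pxE (ys ord0) x; rewrite /px Jt0 normr0 mulr0 => /eqP.
  by rewrite /pz !mulf_eq0 (gt_eqF (mu0 _)) (gt_eqF (expR_gt0 _)) (gt_eqF J1).
(* The right-hand side does not depend on [y], so it cancels between two values of [y]. *)
have lnE y : (stackT T (hinv x) *m (stack lam y)^T) 0 0 - Gam y -
    ((stackT Tt (htinv x) *m (stack lamt y)^T) 0 0 - Gamt y) =
  ln (mut (htinv x)) + ln `|\det (jacobian htinv x)| -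
    (ln (mu (hinv x)) + ln `|\det (jacobian hinv x)|).
  have ln3 (a b s : R) : 0 < a -> 0 < b -> ln (a * expR s * b) = ln a + s + ln b.
    move=> a0 b0; rewrite lnM ?posrE ?mulr_gt0 ?expR_gt0//.
    by rewrite lnM ?posrE ?expR_gt0// expRK.
  have := etrans (esym (ln3 _ _ _ (mu0 _) J1))
    (etrans (congr1 (@ln R) (pxE y x)) (ln3 _ _ _ (mut0 _) Jt1)).
  rewrite (inner_stack T lam) (inner_stack Tt lamt).
  have arith (a b s c a' b' s' c' : R) : a + (s - c) + b = a' + (s' - c') + b' ->
    s - c - (s' - c') = a' + b' - (a + b) by clear; lra.
  exact: arith.
suff E : stackT T (hinv x) *m L^T = stackT Tt (htinv x) *m Lt^T + g.
  by rewrite mulmxA -mulmxDl -E mulmxK.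
apply/rowP => l.
have E (k' : 'I_d -> nat) (S : forall i, R -> 'rV[R]_(k' i))
    (la : forall i, Y -> 'rV[R]_(k' i)) z :
  (stackT S z *m (\matrix_(l < \sum_(i < d) k i)
     (stack la (ys (lift ord0 l)) - stack la (ys ord0)))^T) 0 l =
  (stackT S z *m (stack la (ys (lift ord0 l)))^T) 0 0 -
  (stackT S z *m (stack la (ys ord0))^T) 0 0.
  rewrite [RHS](_ : _ = (stackT S z *m
    (stack la (ys (lift ord0 l)) - stack la (ys ord0))^T) 0 0).
    by rewrite !mxE; apply: eq_bigr => a _; rewrite !mxE.
  by rewrite linearB/= mulmxBr [RHS]mxE [X in _ = _ + X]mxE.
rewrite [RHS]mxE !E [g 0 l]mxE.
have arith (s1 c1 t1 e1 s0 c0 t0 e0 q : R) : s1 - c1 - (t1 - e1) = q ->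
  s0 - c0 - (t0 - e0) = q -> s1 - s0 = t1 - t0 + (c1 - c0 - (e1 - e0)) by clear; lra.
exact: arith (lnE (ys (lift ord0 l))) (lnE (ys ord0)).
Qed.

(** * One nonzero block per block column *)

Lemma block_permutation (k kt : 'I_d -> nat)
  (M : 'M[R]_(\sum_i kt i, \sum_i k i)) (N : 'M[R]_(\sum_i k i, \sum_i kt i)) :
  (forall j, (0 < k j)%N) -> N *m M = 1%:M -> M *m N = 1%:M ->
  (forall i j1 j2, submxblock N j1 i != 0 -> submxblock N j2 i != 0 -> j1 = j2) ->
  (forall j i1 i2, submxblock M i1 j != 0 -> submxblock M i2 j != 0 -> i1 = i2) ->
  exists gamma : 'S_d, forall j,
    [/\ submxblock N j (gamma j) *m submxblock M (gamma j) j = 1%:M,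
        submxblock M (gamma j) j *m submxblock N j (gamma j) = 1%:M &
        forall i, i != gamma j -> submxblock M i j = 0].
Proof.
move=> k0 NM MN uN uM.
have prod (p q r : 'I_d -> nat) (A : 'M[R]_(\sum_i p i, \sum_i q i))
    (B : 'M[R]_(\sum_i q i, \sum_i r i)) i j :
  submxblock (A *m B) i j = \sum_l submxblock A i l *m submxblock B l j.
  by rewrite -{1}[A]submxblockK -{1}[B]submxblockK mul_mxblock mxblockK.
have one (p : 'I_d -> nat) i : submxblock (1%:M : 'M[R]_(\sum_i p i)) i i = 1%:M.
  by rewrite -mxdiagZ submxblock_diag.
(* The diagonal block [j] of [N *m M] is an identity of positive size, hence nonzero, and so is one
   of its summands. Uniqueness in the block columns then makes the choice of [i] injective. *)
have ex j : exists i, submxblock N j i *m submxblock M i j != 0.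
  apply: contrapT => H.
  have : (1%:M : 'M[R]_(k j)) = 0.
    rewrite -one -NM prod big1// => i _.
    by apply/eqP/negPn/negP => ne; apply: H; exists i.
  move=> /matrixP/(_ (Ordinal (k0 j)) (Ordinal (k0 j))).
  by rewrite !mxE eqxx => /eqP; rewrite oner_eq0.
have /choice[f Hf] := ex.
have Nf j : submxblock N j (f j) != 0.
  by apply/eqP => N0; move: (Hf j); rewrite N0 mul0mx eqxx.
have Mf j : submxblock M (f j) j != 0.
  by apply/eqP => M0; move: (Hf j); rewrite M0 mulmx0 eqxx.
have finj : injective f.
  by move=> j1 j2 f12; apply: (uN (f j1)) => //; rewrite f12.
have zero j i : i != f j -> submxblock M i j = 0.
  by move=> ne; apply/eqP/negPn/negP => /uM /(_ (Mf j)) E; rewrite E eqxx in ne.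
exists (perm finj) => j; rewrite permE; split; last exact: zero.
- rewrite -one -NM prod (bigD1 (f j))//= big1 ?addr0// => i /zero ->.
  by rewrite mulmx0.
- rewrite -one -MN prod (bigD1 j)//= big1 ?addr0// => j' ne.
  suff -> : submxblock N j' (f j) = 0 by rewrite mulmx0.
  by apply/eqP/negPn/negP => /uN /(_ (Nf j)) E; rewrite E eqxx in ne.
Qed.

Section OneBlock.
Variables (k kt : 'I_d -> nat).
Variables (T : forall i, R -> 'rV[R]_(k i)) (Tt : forall i, R -> 'rV[R]_(kt i)).
Variables (h hinv ht htinv : 'rV[R]_d -> 'rV[R]_d).
Variables (N : 'M[R]_(\sum_i k i, \sum_i kt i)) (c : 'rV[R]_(\sum_i kt i)).
Hypotheses (hK : cancel h hinv) (hinvK : cancel hinv h).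
Hypotheses (htK : cancel ht htinv) (htinvK : cancel htinv ht).
Hypotheses (seT : strongly_exponential T) (seTt : strongly_exponential Tt).
Hypotheses (dT : forall i t, derivable (T i) t 1)
  (dTt : forall i t, derivable (Tt i) t 1).
Hypothesis stackE :
  forall x, stackT Tt (htinv x) = stackT T (hinv x) *m N + c.

Lemma component_sum i z : Tt i (htinv (h z) 0 i) =
  \sum_j T j (z 0 j) *m submxblock N j i + submxrow c i.
Proof.
have := congr1 (fun A => submxrow A i) (stackE (h z)).
rewrite hK {1}/stackT mxrowK => ->.
rewrite submxrowD stackT_mulmx submxrow_sum; congr (_ + _).
by apply: eq_bigr => j _; rewrite submxblockEv mul_submxrow.
Qed.

Lemma one_block_twice_derivable : cond_V T -> cond_V Tt ->
  forall i j1 j2, submxblock N j1 i != 0 -> submxblock N j2 i != 0 -> j1 = j2.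
Proof.
move=> [ddT _] [ddTt kt2] i j1 j2.
apply: (@at_most_one_block_of_curve R d (kt i) k T (Tt i)
  (fun j => submxblock N j i) (submxrow c i)) => //.
- by move=> j t; have [] := ddT j t.
- exact: strongly_exponential_affinely_spanning.
- by move=> t; have [] := ddTt i t.
- exact: strongly_exponential_affinely_spanning.
- by move=> z; exists (htinv (h z) 0 i); exact: component_sum.
(* Every real [u] is the [i]-th latent coordinate of some observation, so the whole curve [Tt i] is
   covered. *)
- move=> u; exists (hinv (ht (upd 0 i u))).
  by rewrite -component_sum hinvK htK updE eqxx.
Qed.

Lemma one_block_nonmonotone : cond_V' Tt ->
  C1_diffeo h hinv -> C1_diffeo ht htinv ->
  forall i j1 j2, submxblock N j1 i != 0 -> submxblock N j2 i != 0 -> j1 = j2.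
Proof.
move=> V' Ch Cht i; have [kt1 nmono] := V' i.
have kt0 : (0 < kt i)%N by rewrite kt1.
pose b : 'I_(kt i) := Ordinal kt0.
have bE a : a = b.
  by apply/val_inj => /=; apply/eqP; rewrite -leqn0 -ltnS -[X in (_ < X)%N]kt1.
pose tau j t := (T j t *m col b (submxblock N j i)) 0 0.
have dtau j t : derivable (tau j) t 1.
  have := is_derive_mulmx (col b (submxblock N j i)) 0 (@dT j t).
  rewrite (_ : (fun _ => _) = tau j) => [H|]; first exact: ex_derive.
  by apply/funext => s; rewrite addr0.
(* Strong exponentiality on an interval, which has positive measure, excludes that [tau j] is
   constant there. *)
have nc j : submxblock N j i != 0 -> nonconstant_on_intervals (tau j).
  move=> Nj p q pq; apply: contrapT => H; move/eqP: Nj; apply.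
  have cst t : t \in `[p, q]%R -> tau j t = tau j p.
    rewrite in_itv /= => tpq; apply: contrapT => ne.
    by apply: H; exists t.
  have [|||/eqP] := seT (i := j) (U := [set` `[p, q]%R])
    (eta := (col b (submxblock N j i))^T).
  - exact: measurable_itv.
  - by exists (tau j p) => u /cst <-; rewrite /inner trmxK.
  - rewrite lebesgue_measure_itv /= lte_fin pq => /eqP.
    by rewrite -EFinB eqe subr_eq0 gt_eqF.
  - rewrite trmx_eq0 => /eqP/matrixP E; apply/matrixP => a a'.
    by have := E a 0; rewrite !mxE (bE a').
move=> j1 j2 /nc n1 /nc n2.
apply: (@at_most_one_nonmonotone R d h hinv ht htinv i (fun u => Tt i u 0 b)
  tau (submxrow c i 0 b)) => //.
- move=> t; apply: (@continuous_comp _ _ _ (Tt i)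
    (fun u => u 0 b)); last exact: coord_continuous.
  by apply: differentiable_continuous; apply/derivable1_diffP.
- move=> z; rewrite component_sum [LHS]mxE summxE; congr (_ + _).
  by apply: eq_bigr => j _; rewrite /tau -col_mulmx [RHS]mxE.
Qed.

End OneBlock.

(** Substituting one relation into the other makes [stackT T z *m (1%:M - N *m M)] constant in [z],
    and affine spanning makes the matrix zero. *)
Lemma mutually_inverse (k kt : 'I_d -> nat)
  (T : forall i, R -> 'rV[R]_(k i)) (Tt : forall i, R -> 'rV[R]_(kt i))
  (hinv htinv h : 'rV[R]_d -> 'rV[R]_d) M N c c' :
  cancel h hinv -> (forall i, affinely_spanning (T i)) ->
  (forall x, stackT T (hinv x) = stackT Tt (htinv x) *m M + c) ->
  (forall x, stackT Tt (htinv x) = stackT T (hinv x) *m N + c') ->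
  N *m M = 1%:M.
Proof.
move=> hK ndT E1 E2.
have E z : stackT T z *m (1%:M - N *m M) = c' *m M + c.
  rewrite mulmxBr mulmx1 -{1}(hK z) E1 E2 hK mulmxDl mulmxA.
  by rewrite -[X in X - _]addrA [LHS]addrC addKr.
apply/esym/eqP; rewrite -subr_eq0; apply/eqP.
by apply: (stackT_constant_eq0 ndT) => z z'; rewrite !E.
Qed.

End Stacked.

Theorem mainTheorem19 (R : realType) (d : nat) (Y : Type)
  (k kt : 'I_d -> nat)
  (T : forall i : 'I_d, R -> 'rV[R]_(k i))
  (Tt : forall i : 'I_d, R -> 'rV[R]_(kt i))
  (lam : forall i : 'I_d, Y -> 'rV[R]_(k i))
  (lamt : forall i : 'I_d, Y -> 'rV[R]_(kt i))
  (mu mut : 'rV[R]_d -> R) (Gam Gamt : Y -> R)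
  (h hinv ht htinv : 'rV[R]_d -> 'rV[R]_d) :
  imca_basic T lam mu Gam h hinv ->
  imca_basic Tt lamt mut Gamt ht htinv ->
  ((cond_V T /\ cond_V Tt /\ D2_diffeo h hinv /\ D2_diffeo ht htinv) \/
   (cond_V' T /\ cond_V' Tt /\ C1_diffeo h hinv /\ C1_diffeo ht htinv)) ->
  (forall (y : Y) (x : 'rV[R]_d),
      px T lam mu Gam hinv y x = px Tt lamt mut Gamt htinv y x) ->
  exists (gamma : 'S_d)
         (A : forall i : 'I_d, 'M[R]_(kt (gamma i), k i))
         (b : forall i : 'I_d, 'rV[R]_(k i)),
    (forall i : 'I_d,
       k i = kt (gamma i) /\
       exists B : 'M[R]_(k i, kt (gamma i)),
         A i *m B = 1%:M /\ B *m A i = 1%:M) /\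
    (forall (i : 'I_d) (x : 'rV[R]_d),
       T i (hinv x 0 i) = Tt (gamma i) (htinv x 0 (gamma i)) *m A i + b i).
Proof.
move=> [mu0 _ [hK hinvK] [seT dT] [ys [_ uL]]].
move=> [mut0 _ [htK htinvK] [seTt dTt] [yst [_ uLt]]] cases pxE.
have [dh dhinv dht dhtinv] : [/\ partially_derivable h, partially_derivable hinv,
    partially_derivable ht & partially_derivable htinv].
  by case: cases => [] [_ [_ [[_ [_ H]] [_ [_ Ht]]]]];
    (split; [case: (H h (or_introl erefl))|case: (H hinv (or_intror erefl))|
       case: (Ht ht (or_introl erefl))|case: (Ht htinv (or_intror erefl))]).
have k0 j : (0 < k j)%N.
  case: cases => [[[_ k2] _]|[V' _]]; first exact: ltnW (k2 j).
  by have [k1 _] := V' j; rewrite k1.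
have [M [c Mgood]] := stackT_affine_of_densities mu0 mut0 uL pxE.
have [N [c' Ngood]] := stackT_affine_of_densities mut0 mu0 uLt
  (fun y x => esym (pxE y x)).
(* [Mgood] covers the points with nonzero Jacobian determinant; these are dense, and the relation
   extends entry by entry. *)
have ME x : stackT T (hinv x) = stackT Tt (htinv x) *m M + c.
  apply/rowP => l.
  apply: (sep_dense_eq (g1 := hinv) (g2 := htinv) (u := fun z => stackT T z 0 l)
    (v := fun z => (stackT Tt z *m M + c) 0 l)
    (P := [set x | \det (Defs.jacobian hinv x) != 0])) => //.
  - exact: stackT_coord_continuous.
  - exact: stackT_affine_continuous.
  - move=> a r r0; exact: (jacobian_nonsingular_dense a hinvK hK dhinv dh r0).
  - by move=> w /Mgood ->.
have NE x : stackT Tt (htinv x) = stackT T (hinv x) *m N + c'.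
  apply/rowP => l.
  apply: (sep_dense_eq (g1 := htinv) (g2 := hinv) (u := fun z => stackT Tt z 0 l)
    (v := fun z => (stackT T z *m N + c') 0 l)
    (P := [set x | \det (Defs.jacobian htinv x) != 0])) => //.
  - exact: stackT_coord_continuous.
  - exact: stackT_affine_continuous.
  - move=> a r r0; exact: (jacobian_nonsingular_dense a htinvK htK dhtinv dht r0).
  - by move=> w /Ngood ->.
have spT := strongly_exponential_affinely_spanning seT.
have spTt := strongly_exponential_affinely_spanning seTt.
have NM := mutually_inverse hK spT ME NE.
have MN := mutually_inverse htK spTt NE ME.
have uN i j1 j2 : submxblock N j1 i != 0 -> submxblock N j2 i != 0 -> j1 = j2.
  case: cases => [[V [Vt _]]|[V [Vt [Ch Cht]]]].
    exact: (one_block_twice_derivable hK hinvK htK seT seTt dT dTt NE V Vt).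
  exact: (one_block_nonmonotone hK seT dT dTt NE Vt Ch Cht).
have uM j i1 i2 : submxblock M i1 j != 0 -> submxblock M i2 j != 0 -> i1 = i2.
  case: cases => [[V [Vt _]]|[V [Vt [Ch Cht]]]].
    exact: (one_block_twice_derivable htK htinvK hK seTt seT dTt dT ME Vt V).
  exact: (one_block_nonmonotone htK seTt dTt dT ME V Cht Ch).
have [gamma Hg] := block_permutation k0 NM MN uN uM.
exists gamma, (fun i => submxblock M (gamma i) i), (fun i => submxrow c i).
split=> [i|i x]; have [NMi MNi Mi] := Hg i.
  split; last by exists (submxblock N i (gamma i)).
  (* Each of the two one-sided inverse relations bounds one block size by the other. *)
  by apply/eqP; rewrite eqn_leq (mulmx1_min NMi) (mulmx1_min MNi).
have := component_sum htK ME i (htinv x); rewrite htinvK => ->.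
rewrite (bigD1 (gamma i))//= big1 ?addr0// => j /Mi ->.
by rewrite mulmx0.
Qed.
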